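(* Let $A\in\mathbf{RM}_5$ be a reciprocal $5\times5$ matrix with associated parameters $\xi_1,\xi_2,\xi_3,\xi_4\ge0$. (a) If $\xi_1=\xi_4$ or $\xi_1-\xi_4=2(\xi_3-\xi_2)$, then the rank-2 numerical range $\Lambda_2(A)$ is the elliptical disk with foci $\pm1$ and minor axis of (full) length $\sqrt{2(\xi_1+\xi_4)}$. (b) If $\xi_2\xi_3=0$, $\xi_2+\xi_3\neq0$, $\xi_1=\frac{\sqrt3}{2}(\xi_2+\xi_3)+\xi_3$ and $\xi_4=\frac{\sqrt3}{2}(\xi_2+\xi_3)+\xi_2$, then $\Lambda_2(A)$ is the intersection of the two elliptical disks bounded by $E_1$ and $E_2$, where $E_1$ is the ellipse with foci $\sqrt3,-1$, $E_2$ is the ellipse with foci $-\sqrt3,1$, and both have minor axis of (full) length $(1+\sqrt3)\sqrt{\xi_2+\xi_3}$.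
   Context: A matrix $A=(a_{ij})\in M_n(\mathbb C)$ is reciprocal, $A\in\mathbf{RM}_n$, if it is tridiagonal with zero main diagonal ($a_{ij}=0$ whenever $|i-j|\neq1$) and $a_{i,i+1}a_{i+1,i}=1$ for $i=1,\dots,n-1$. Its parameters are $\xi_j=\frac14(|a_{j,j+1}|-|a_{j+1,j}|)^2\ge 0$, $j=1,\dots,n-1$. The rank-$k$ numerical range of $A\in M_n(\mathbb C)$ is $\Lambda_k(A)=\{\lambda\in\mathbb C: PAP=\lambda P\text{ for some rank-}k\text{ orthogonal projection }P\}$. An elliptical disk with minor axis of length zero is the line segment joining its foci. *)

(* Defs.v *)
From HB Require Import structures.
From mathcomp Require Import all_boot all_order all_algebra.
From mathcomp Require Import complex.
From mathcomp Require Import boolp classical_sets reals.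

Set Implicit Arguments.
Unset Strict Implicit.
Unset Printing Implicit Defensive.

Import Order.TTheory GRing.Theory Num.Theory.
Local Open Scope ring_scope.
Local Open Scope complex_scope.
Local Open Scope classical_set_scope.
Local Open Scope sesquilinear_scope.

Definition reciprocal (R : realType) (n : nat) (A : 'M[R[i]]_n) : Prop :=
  (forall i j : 'I_n, j != i.+1 :> nat -> i != j.+1 :> nat -> A i j = 0) /\
  (forall i j : 'I_n, j = i.+1 :> nat -> A i j * A j i = 1).

(* Indices start at 0: [rparam A j] is the parameter \xi_{j+1}, built from the
   entries in positions (j, j+1) and (j+1, j). *)
Definition rparam (R : realType) (n : nat) (A : 'M[R[i]]_n.+1) (j : 'I_n) : R :=
  let j0 := widen_ord (leqnSn n) j in
  let j1 := lift ord0 j in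
  (Normc.normc (A j0 j1) - Normc.normc (A j1 j0)) ^+ 2 / 4%:R.

Definition orthogonal_projection (R : realType) (n : nat) (P : 'M[R[i]]_n) :
  Prop := P *m P = P /\ P ^t* = P.

Definition rank_numrange (R : realType) (k n : nat) (A : 'M[R[i]]_n) :
  set R[i] :=
  [set lambda : R[i] | exists P : 'M[R[i]]_n,
     [/\ orthogonal_projection P, \rank P = k &
         P *m A *m P = lambda *: P]].

(* [d] is the full length of the minor axis, so that the major axis has length
   sqrt (d^2 + |f1 - f2|^2); for [d = 0] this is the segment [f1, f2]. *)
Definition elliptical_disk (R : realType) (f1 f2 : R[i]) (d : R) : set R[i] :=
  [set z : R[i] | Normc.normc (z - f1) + Normc.normc (z - f2)
                  <= Num.sqrt (d ^+ 2 + Normc.normc (f1 - f2) ^+ 2)].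

(* Main.v *)
(* Put M = A - l.  A row vector v with v (z M + M^* ) = 0 and one v' for z' satisfy
   v M v'^* = 0 unless z conj z' = 1, so two null vectors of the pencil with z, z'
   in the open unit disk span a plane that is isotropic for M, and l lies in the
   rank-2 numerical range.  For a reciprocal 5 x 5 matrix the pencil is
   tridiagonal, the vanishing of its determinant factors under the hypotheses
   into two self-inversive quadratics in z, one per ellipse, and each has a root in
   the open disk when l is strictly inside its ellipse.  The degenerate and
   boundary cases follow by perturbing the parameters and compactness of the set
   of projections.  Conversely, an isotropic plane meets every subspace of
   dimension 4, so Re (z l) is at most the second largest eigenvalue of the
   Hermitian part of z A, which the same factorization bounds by the support
   function of each ellipse. *)
Require Import Defs.
From HB Require Import structures.
From mathcomp Require Import all_boot all_order all_algebra.
From mathcomp Require Import complex.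
From mathcomp Require Import boolp classical_sets reals.
From mathcomp Require Import zify ring lra.
From mathcomp Require Import topology normedtype realfun.

Set Implicit Arguments.
Unset Strict Implicit.
Unset Printing Implicit Defensive.

Import Order.TTheory GRing.Theory Num.Theory.
Import numFieldNormedType.Exports.
Local Open Scope ring_scope.
Local Open Scope complex_scope.
Local Open Scope classical_set_scope.
Local Open Scope sesquilinear_scope.

(** * Moduli, elliptical disks and 2 x 2 forms *)

Lemma normc_ge0 (R : realType) (z : R[i]) : 0 <= Normc.normc z.
Proof. by case: z => a b; exact: sqrtr_ge0. Qed.

Lemma normc_sqr (R : realType) (z : R[i]) :
  Normc.normc z ^+ 2 = complex.Re z ^+ 2 + complex.Im z ^+ 2.
Proof. by case: z => a b; rewrite sqr_sqrtr // addr_ge0 ?sqr_ge0. Qed.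

Lemma mul_conj_normc (R : realType) (z : R[i]) :
  z * z^*%R = (Normc.normc z ^+ 2)%:C.
Proof.
rewrite normc_sqr; case: z => a b; apply/eqP; rewrite eq_complex /=.
by apply/andP; split; apply/eqP; ring.
Qed.

Lemma normc_real (R : realType) (x : R) : Normc.normc x%:C = `|x|.
Proof. by rewrite /= expr0n /= addr0 sqrtr_sqr. Qed.

Lemma normc_conj (R : realType) (z : R[i]) :
  Normc.normc z^*%R = Normc.normc z.
Proof. by case: z => a b /=; rewrite sqrrN. Qed.

(** With p, q the distances to the foci, squaring p + q <= sqrt (d^2 + 4 k^2) and using p^2 + q^2 =
    2 |z - al|^2 + 2 k^2 bounds p q, the modulus on the left. *)
Lemma elliptical_diskE (R : realType) (al k d : R) (z : R[i]) :
  elliptical_disk (al + k)%:C (al - k)%:C d z <->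
  Normc.normc ((z - al%:C) ^+ 2 - (k ^+ 2)%:C)
    <= k ^+ 2 + d ^+ 2 / 2 - Normc.normc (z - al%:C) ^+ 2.
Proof.
rewrite /elliptical_disk /mkset.
set f1 := (al + k)%:C; set f2 := (al - k)%:C.
have -> : (z - al%:C) ^+ 2 - (k ^+ 2)%:C = (z - f1) * (z - f2).
  by rewrite /f1 /f2 rmorphD rmorphB rmorphXn /=; ring.
rewrite Normc.normcM.
have -> : f1 - f2 = (2 * k)%:C by rewrite /f1 /f2 -rmorphB /=; congr _%:C; ring.
have par : Normc.normc (z - f1) ^+ 2 + Normc.normc (z - f2) ^+ 2
         = 2 * Normc.normc (z - al%:C) ^+ 2 + 2 * k ^+ 2.
  by rewrite !normc_sqr /f1 /f2; case: (z) => a b /=; ring.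
move: (normc_ge0 (z - f1)) (normc_ge0 (z - f2)) par.
rewrite !normc_real real_normK ?num_real //.
move: (Normc.normc _) (Normc.normc _) (Normc.normc _) => p q r p0 q0 par.
rewrite -(ler_pXn2r (n := 2)) ?nnegrE ?sqrtr_ge0 ?addr_ge0 //.
rewrite sqr_sqrtr ?addr_ge0 ?sqr_ge0 //.
by split=> ?; nra.
Qed.

(** The witness is the root of smaller modulus, in the rationalized form conj a / (d + sqrt (d^2 -
    |a|^2)), which also covers [a = 0]. *)
Lemma self_inversive_root (R : realType) (a : R[i]) (d : R) :
  Normc.normc a < d -> exists z : R[i],
    Normc.normc z < 1 /\ a * z ^+ 2 - 2 * d%:C * z + a^*%R = 0.
Proof.
move=> ad; have a0 := normc_ge0 a.
have r0 : 0 <= d ^+ 2 - Normc.normc a ^+ 2 by nra.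
pose r := Num.sqrt (d ^+ 2 - Normc.normc a ^+ 2).
have r2 : r ^+ 2 = d ^+ 2 - Normc.normc a ^+ 2 by rewrite sqr_sqrtr.
have rge : 0 <= r by exact: sqrtr_ge0.
have k0 : 0 < d + r by lra.
have kC : (d + r)%:C != 0 :> R[i].
  by rewrite -(rmorph0 (real_complex R)) (inj_eq (@complexI R)) gt_eqF.
exists (a^*%R / (d + r)%:C); split.
  rewrite Normc.normcM Normc.normcV normc_real gtr0_norm //.
  rewrite normc_conj.
  by rewrite ltr_pdivrMr // mul1r; lra.
have e : a * a^*%R - 2 * d%:C * (d + r)%:C + (d + r)%:C ^+ 2 = 0.
  rewrite mul_conj_normc; have -> : Normc.normc a ^+ 2 = d ^+ 2 - r ^+ 2 by lra.
  by rewrite rmorphB !rmorphXn rmorphD /=; ring.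
move: (d + r)%:C kC e => K K0 e.
transitivity (a^*%R / K ^+ 2 * (a * a^*%R - 2 * d%:C * K + K ^+ 2)).
  by field.
by rewrite e mulr0.
Qed.

Lemma quadratic_form_neg (R : realType) (p q r : R) :
  ~ [/\ 0 <= p, 0 <= r & q ^+ 2 <= p * r] ->
  exists x y : R, p * x ^+ 2 + 2 * q * x * y + r * y ^+ 2 < 0.
Proof.
move=> H.
have [p0|p0] := ltP p 0; first by exists 1, 0; lra.
have [r0|r0] := ltP r 0; first by exists 0, 1; lra.
have [|qpr] := leP (q ^+ 2) (p * r); first by move=> h; case: H.
(* At (-q, p) the form equals p (p r - q^2), and at (r, -q) it equals r (p r - q^2). *)
have [->|pn] := eqVneq p 0; last first.
  have p1 : 0 < p by rewrite lt_def pn.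
  by exists (- q), p; nra.
have [->|rn] := eqVneq r 0; last first.
  have r1 : 0 < r by rewrite lt_def rn.
  by exists r, (- q); nra.
exists (- q), 1.
have : 0 < q ^+ 2 by nra.
lra.
Qed.

(** Rotating [x] by the phase of conj q makes the cross term real and reduces to
    [quadratic_form_neg]. *)
Lemma hermitian_form_neg (R : realType) (p r : R) (q : R[i]) :
  ~ [/\ 0 <= p, 0 <= r & Normc.normc q ^+ 2 <= p * r] ->
  exists x y : R[i],
    p * Normc.normc x ^+ 2 + 2 * complex.Re (q * x * y^*%R) + r * Normc.normc y ^+ 2 < 0.
Proof.
move=> H.
have [x [y h]] := @quadratic_form_neg R p (Normc.normc q) r H.
have [q0|qn] := eqVneq q 0.
  exists x%:C, y%:C; move: h; rewrite q0 Normc.normc0 !normc_real.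
  by rewrite !real_normK ?num_real // !mul0r [complex.Re _]/=; lra.
have nq : Normc.normc q != 0 by apply/eqP => /Normc.eq0_normc /eqP; rewrite (negbTE qn).
exists (x%:C * q^*%R / (Normc.normc q)%:C), y%:C.
have -> : q * (x%:C * q^*%R / (Normc.normc q)%:C) * (y%:C)^*%R
    = (Normc.normc q * x * y)%:C.
  have -> : (y%:C)^*%R = y%:C :> R[i] by exact: conjc_real.
  transitivity (q * q^*%R * x%:C * y%:C / (Normc.normc q)%:C).
    by ring.
  rewrite mul_conj_normc rmorphXn !rmorphM /=; field.
  by rewrite -(rmorph0 (real_complex R)) (inj_eq (@complexI R)).
rewrite !Normc.normcM Normc.normcV !normc_real !exprMn.
rewrite normc_conj.
rewrite exprVn !real_normK ?num_real // mulfK ?expf_neq0 //=; lra.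
Qed.

(** * Projections and isotropic subspaces *)

Lemma trCmxM (R : realType) (m n p : nat) (X : 'M[R[i]]_(m, n))
    (Y : 'M[R[i]]_(n, p)) : (X *m Y)^t* = Y^t* *m X^t*.
Proof. by rewrite trmx_mul map_mxM. Qed.

Lemma row_sqnorm_eq0 (R : realType) (n : nat) (u : 'rV[R[i]]_n) :
  u *m u^t* = 0 -> u = 0.
Proof.
move=> /matrixP /(_ 0 0); rewrite !mxE => h.
have {h} /psumr_eq0P h : \sum_j `|u 0 j| ^+ 2 = 0.
  by rewrite -[RHS]h; apply: eq_bigr => j _; rewrite !mxE normCK.
apply/rowP => j; rewrite mxE; apply/eqP.
by rewrite -normr_eq0 -sqrf_eq0 h // => i _; rewrite exprn_ge0.
Qed.

(** The Gram matrix G = X X^* is invertible, as v G = 0 makes v X a vector of norm 0; X^* G^-1 X is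
    then the orthogonal projection onto the row space of [X]. *)
Lemma rank_numrange_isotropic (R : realType) (k n : nat) (A : 'M[R[i]]_n)
    (X : 'M[R[i]]_(k, n)) (l : R[i]) :
  row_free X -> X *m (A - l%:M) *m X^t* = 0 -> rank_numrange k A l.
Proof.
move=> Xfree XAX.
pose G := X *m X^t*.
have GH : G^t* = G by rewrite /G trCmxM trmxCK.
have Gu : G \in unitmx.
  rewrite -row_free_unit; apply: inj_row_free => v vG.
  have : (v *m X) *m (v *m X)^t* = 0.
    by rewrite trCmxM mulmxA -(mulmxA v) -/G vG mul0mx.
  by move=> /row_sqnorm_eq0 /eqP; rewrite mulmx_free_eq0 // => /eqP.
have XA : X *m A *m X^t* = l *: G.
  apply/eqP; rewrite -subr_eq0 -XAX; apply/eqP.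
  by rewrite mulmxBr mulmxBl mul_mx_scalar -scalemxAl.
pose P := X^t* *m invmx G *m X.
have XP : X *m P = X by rewrite /P !mulmxA -/G mulmxV // mul1mx.
exists P; split.
- split; first by rewrite {1}/P -(mulmxA _ X P) XP.
  by rewrite /P !trCmxM trmxCK trmx_inv map_invmx GH mulmxA.
- apply/eqP; rewrite eqn_leq; apply/andP; split.
    by apply: (leq_trans (mxrankM_maxr _ _)); rewrite rank_leq_row.
  by move: Xfree; rewrite -row_leq_rank => /leq_trans; apply;
     rewrite -{1}XP mxrankM_maxr.
- transitivity (X^t* *m invmx G *m (X *m A *m X^t*) *m (invmx G *m X)).
    by rewrite /P !mulmxA.
  rewrite XA -scalemxAr -scalemxAl -(mulmxA _ (invmx G) G) mulVmx // mulmx1.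
  by rewrite mulmxA.
Qed.

(** The row space of the projection has dimension k > m, so it meets the left kernel of [B]. *)
Lemma rank_numrange_vector (R : realType) (k m n : nat) (A : 'M[R[i]]_n)
    (B : 'M[R[i]]_(n, m)) (l : R[i]) :
  (m < k)%N -> rank_numrange k A l ->
  exists v : 'rV[R[i]]_n,
    [/\ v != 0, v *m B = 0 & v *m (A - l%:M) *m v^t* = 0].
Proof.
move=> mk [P [[PP PH] rP PAP]].
pose v := nz_row (P :&: kermx B)%MS.
have vK : (v <= P :&: kermx B)%MS by exact: nz_row_sub.
exists v; split.
- rewrite nz_row_eq0 -mxrank_eq0 -lt0n.
  have := mxrank_mul_ker P B; rewrite rP => rk.
  have := rank_leq_col (P *m B).
  by move: rk mk; move: (\rank _) (\rank _) => a b; lia.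
- by apply/sub_kermxP; apply: submx_trans vK _; exact: capmxSr.
- have /submxP [y ->] : (v <= P)%MS.
    by apply: submx_trans vK _; exact: capmxSl.
  transitivity (y *m (P *m (A - l%:M) *m P) *m y^t*).
    by rewrite trCmxM PH !mulmxA.
  by rewrite mulmxBr mulmxBl PAP mul_mx_scalar -scalemxAl PP subrr mulmx0 mul0mx.
Qed.

(** In a full-rank factorization P = C B idempotence forces B C = 1, and the trace is cyclic. Unlike
    the rank, the trace passes to limits. *)
Lemma idempotent_mxtrace (F : fieldType) (n : nat) (P : 'M[F]_n) :
  P *m P = P -> \tr P = (\rank P)%:R.
Proof.
move=> PP.
have BC : row_base P *m col_base P = 1%:M.
  have e : col_base P *m (row_base P *m col_base P) *m row_base P
         = col_base P *m 1%:M *m row_base P.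
    by rewrite mulmx1 mulmxA -mulmxA !mulmx_base.
  exact: (row_full_inj (col_base_full P) (row_free_inj (row_base_free P) e)).
by rewrite -{1}(mulmx_base P) mxtrace_mulC BC mxtrace1.
Qed.

(** * Closedness of the rank-k numerical range *)

Lemma fmap_ultra (T U : Type) (f : T -> U) (F : set_system T) :
  UltraFilter F -> UltraFilter (f @ F).
Proof.
move=> FU; split; first exact: fmap_proper_filter.
move=> G GP sub; apply/seteqP; split=> [A GA|]; last exact: sub.
have [//|FnA] := in_ultra_setVsetC (f @^-1` A) FU.
have GnA : G (~` A) by exact: sub.
have : G (A `&` ~` A) by exact: filterI.
by rewrite setICr => /filter_ex [].
Qed.

(** Compactness of a segment in ultrafilter form; it replaces the extraction of convergent
    subsequences. *)
Lemma ultra_bounded_cvg (R : realType) (T : Type) (F : set_system T)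
    (f : T -> R) (M : R) :
  UltraFilter F -> F [set t | f t ^+ 2 <= M] -> exists l : R, f t @[t --> F] --> l.
Proof.
move=> FU fM; have := @segment_compact R (- (M + 1)) (M + 1).
rewrite compact_ultra => /(_ _ (fmap_ultra f FU)) [|l [_ fl]]; last by exists l.
apply: (@filterS _ F _ [set t | f t ^+ 2 <= M]) => // t /= h.
rewrite in_itv /=.
have := sqr_ge0 (f t - 1); have := sqr_ge0 (f t + 1).
by move=> h1 h2; apply/andP; split; lra.
Qed.

Definition ccvg (R : realType) (T : Type) (F : set_system T) (f : T -> R[i])
    (l : R[i]) : Prop :=
  complex.Re (f t) @[t --> F] --> complex.Re l /\
  complex.Im (f t) @[t --> F] --> complex.Im l.

Lemma ccvgD (R : realType) (T : Type) (F : set_system T) (f g : T -> R[i])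
    (l m : R[i]) : ProperFilter F ->
  ccvg F f l -> ccvg F g m -> ccvg F (fun t => f t + g t) (l + m).
Proof.
move=> FF [f1 f2] [g1 g2]; split.
  rewrite (_ : (fun t => _) = (fun t => complex.Re (f t) + complex.Re (g t))).
    by rewrite (raddfD (@complex.Re R)); exact: cvgD.
  by apply/funext => t; rewrite raddfD.
rewrite (_ : (fun t => _) = (fun t => complex.Im (f t) + complex.Im (g t))).
  by rewrite (raddfD (@complex.Im R)); exact: cvgD.
by apply/funext => t; rewrite raddfD.
Qed.

Lemma ccvgM (R : realType) (T : Type) (F : set_system T) (f g : T -> R[i])
    (l m : R[i]) : ProperFilter F ->
  ccvg F f l -> ccvg F g m -> ccvg F (fun t => f t * g t) (l * m).
Proof.
move=> FF; case: l m => a b [c d] [/= f1 f2] [/= g1 g2]; split => /=.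
  rewrite (_ : (fun t => _) = (fun t => complex.Re (f t) * complex.Re (g t)
     - complex.Im (f t) * complex.Im (g t))).
    by apply: cvgB; exact: cvgM.
  by apply/funext => t; case: (f t) => ? ?; case: (g t).
rewrite (_ : (fun t => _) = (fun t => complex.Re (f t) * complex.Im (g t)
   + complex.Im (f t) * complex.Re (g t))).
  by apply: cvgD; exact: cvgM.
by apply/funext => t; case: (f t) => ? ?; case: (g t).
Qed.

Lemma ccvg_cst (R : realType) (T : Type) (F : set_system T) (l : R[i]) :
  ProperFilter F -> ccvg F (fun=> l) l.
Proof. by move=> FF; split; exact: cvg_cst. Qed.

Lemma ccvg_sum (R : realType) (T I : Type) (F : set_system T) (r : seq I)
    (f : I -> T -> R[i]) (l : I -> R[i]) : ProperFilter F ->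
  (forall i, ccvg F (f i) (l i)) ->
  ccvg F (fun t => \sum_(i <- r) f i t) (\sum_(i <- r) l i).
Proof.
move=> FF fl; elim: r => [|i r IH].
  rewrite big_nil (_ : (fun t => _) = fun=> 0); first exact: ccvg_cst.
  by apply/funext => t; rewrite big_nil.
rewrite big_cons (_ : (fun t => _) = fun t => f i t + \sum_(i <- r) f i t).
  exact: ccvgD.
by apply/funext => t; rewrite big_cons.
Qed.

Lemma ccvg_conj (R : realType) (T : Type) (F : set_system T) (f : T -> R[i])
    (l : R[i]) : ProperFilter F ->
  ccvg F f l -> ccvg F (fun t => (f t)^*%R) l^*%R.
Proof.
move=> FF; case: l => a b [/= f1 f2]; split => /=.
  rewrite (_ : (fun t => _) = (fun t => complex.Re (f t))) //.
  by apply/funext => t; case: (f t).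
rewrite (_ : (fun t => _) = (fun t => - complex.Im (f t))); first exact: cvgN.
by apply/funext => t; case: (f t).
Qed.

Lemma ccvg_unique (R : realType) (T : Type) (F : set_system T)
    (f g : T -> R[i]) (l m : R[i]) : ProperFilter F ->
  ccvg F f l -> ccvg F g m -> F [set t | f t = g t] -> l = m.
Proof.
move=> FF [f1 f2] [g1 g2] fg.
have lim_eq (h k : T -> R) (a b : R) : h t @[t --> F] --> a -> k t @[t --> F] --> b ->
    F [set t | h t = k t] -> a = b.
  move=> ha kb hk.
  have hb : h t @[t --> F] --> b.
    by apply: cvg_trans kb; apply: near_eq_cvg; apply: filterS hk => t /= ->.
  exact: (@cvg_unique _ (@Rhausdorff R) _ _ _ _ ha hb).
apply/eqP; rewrite eq_complex; apply/andP; split; apply/eqP.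
  by apply: lim_eq f1 g1 _; apply: filterS fg => t /= ->.
by apply: lim_eq f2 g2 _; apply: filterS fg => t /= ->.
Qed.

(** The squared moduli of all entries add up to the trace of P P^* = P, which is k. *)
Lemma projection_entry_bound (R : realType) (n k : nat) (P : 'M[R[i]]_n) i j :
  orthogonal_projection P -> \rank P = k ->
  complex.Re (P i j) ^+ 2 <= k%:R /\ complex.Im (P i j) ^+ 2 <= k%:R.
Proof.
move=> [PP PH] rP.
have trP : \sum_i \sum_j `|P i j| ^+ 2 = k%:R.
  rewrite -rP -(idempotent_mxtrace PP) /mxtrace; apply: eq_bigr => a _.
  rewrite -{2}PP mxE; apply: eq_bigr => b _.
  by rewrite normCK; congr (_ * _); rewrite -{2}PH !mxE.
have : `|P i j| ^+ 2 <= k%:R.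
  rewrite -trP (bigD1 i) //= (bigD1 j) //= -addrA lerDl addr_ge0 //.
    by apply: sumr_ge0 => b _; rewrite exprn_ge0.
  by apply: sumr_ge0 => a _; apply: sumr_ge0 => b _; rewrite exprn_ge0.
rewrite -add_Re2_Im2 -(rmorph_nat (real_complex R)) lecR => h.
by split; move: h (sqr_ge0 (complex.Re (P i j))) (sqr_ge0 (complex.Im (P i j))); lra.
Qed.

(** Along an ultrafilter finer than [F] the bounded entries of the projections converge, and the
    equations and the trace pass to the limit. *)
Lemma rank_numrange_closed (R : realType) (T : Type) (F : set_system T)
    (k n : nat) (A : 'M[R[i]]_n) (B : T -> 'M[R[i]]_n) (l : R[i]) :
  ProperFilter F -> (forall i j, ccvg F (fun t => B t i j) (A i j)) ->
  F [set t | rank_numrange k (B t) l] -> rank_numrange k A l.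
Proof.
move=> FF BA Fl.
have [U [UU sFU]] := ultraFilterLemma FF.
have UP : ProperFilter U by exact: ultra_proper.
have {}BA i j : ccvg U (fun t => B t i j) (A i j).
  by have [h1 h2] := BA i j; split=> S /= hS; apply: sFU; [exact: h1|exact: h2].
have {Fl} := sFU _ Fl.
(* A projection is chosen for every [t], with 0 as default value where none exists. *)
have /choice [P hP] : forall t, exists Q, rank_numrange k (B t) l ->
    [/\ orthogonal_projection Q, \rank Q = k & Q *m B t *m Q = l *: Q].
  move=> t.
  have [[Q hQ]|h] := pselect (rank_numrange k (B t) l); first by exists Q.
  by exists 0.
move=> /(filterS hP) {}hP.
have [Q PQ] : exists Q : 'M[R[i]]_n,
    forall i j, ccvg U (fun t => P t i j) (Q i j).
  have h (ij : 'I_n * 'I_n) : exists q, ccvg U (fun t => P t ij.1 ij.2) q.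
    have [|a ha] := @ultra_bounded_cvg R T U
      (fun t => complex.Re (P t ij.1 ij.2)) k%:R UU.
      by apply: filterS hP => t [h1 h2 _];
         have [] := projection_entry_bound ij.1 ij.2 h1 h2.
    have [|b hb] := @ultra_bounded_cvg R T U
      (fun t => complex.Im (P t ij.1 ij.2)) k%:R UU.
      by apply: filterS hP => t [h1 h2 _];
         have [] := projection_entry_bound ij.1 ij.2 h1 h2.
    by exists (a +i* b).
  have [q hq] := choice h.
  by exists (\matrix_(i, j) q (i, j)) => i j; rewrite mxE; exact: (hq (i, j)).
have mulcvg (X Y : T -> 'M[R[i]]_n) (X' Y' : 'M[R[i]]_n) :
    (forall i j, ccvg U (fun t => X t i j) (X' i j)) ->
    (forall i j, ccvg U (fun t => Y t i j) (Y' i j)) ->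
    forall i j, ccvg U (fun t => (X t *m Y t) i j) ((X' *m Y') i j).
  move=> hX hY i j; rewrite mxE.
  rewrite (_ : (fun t => _) = fun t => \sum_s X t i s * Y t s j).
    by apply: ccvg_sum => s; exact: ccvgM.
  by apply/funext => t; rewrite mxE.
have lim_eq (X Y : T -> 'M[R[i]]_n) (X' Y' : 'M[R[i]]_n) :
    (forall i j, ccvg U (fun t => X t i j) (X' i j)) ->
    (forall i j, ccvg U (fun t => Y t i j) (Y' i j)) ->
    U [set t | X t = Y t] -> X' = Y'.
  move=> hX hY XY; apply/matrixP => i j.
  by apply: (ccvg_unique UP (hX i j) (hY i j)); apply: filterS XY => t /= ->.
have QQ : Q *m Q = Q.
  apply: (lim_eq _ _ _ _ (mulcvg _ _ _ _ PQ PQ) PQ).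
  by apply: filterS hP => t [[]].
exists Q; split.
- split=> //.
  have PQc i j : ccvg U (fun t => (P t)^t* i j) (Q^t* i j).
    rewrite !mxE (_ : (fun t => _) = fun t => (P t j i)^*%R); first exact: ccvg_conj.
    by apply/funext => t; rewrite !mxE.
  by apply: (lim_eq _ _ _ _ PQc PQ); apply: filterS hP => t [[]].
- have : \tr Q = k%:R.
    apply: (ccvg_unique UP (f := fun t => \tr (P t)) (g := fun=> k%:R)).
    + by apply: ccvg_sum => i.
    + exact: ccvg_cst.
    + by apply: filterS hP => t [[PP _] rP _]; rewrite /= idempotent_mxtrace ?rP.
  by rewrite (idempotent_mxtrace QQ) => /eqP; rewrite eqr_nat => /eqP.
- have lcvg i j : ccvg U (fun t => (l *: P t) i j) ((l *: Q) i j).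
    rewrite mxE (_ : (fun t => _) = fun t => l * P t i j).
      by apply: ccvgM => //; exact: ccvg_cst.
    by apply/funext => t; rewrite mxE.
  apply: (lim_eq _ _ _ _ (mulcvg _ _ _ _ (mulcvg _ _ _ _ PQ BA) PQ) lcvg).
  by apply: filterS hP => t [].
Qed.

(** * Tridiagonal matrices and their pencils *)

Definition tridiag (R : realType) (n : nat) (a b : nat -> R[i]) : 'M[R[i]]_n :=
  \matrix_(i, j) if j == i.+1 :> nat then a i
                 else if i == j.+1 :> nat then b j else 0.

Definition xi (R : realType) (a b : nat -> R[i]) (i : nat) : R :=
  (Normc.normc (a i) - Normc.normc (b i)) ^+ 2 / 4.

Lemma reciprocal_tridiag (R : realType) (n : nat) (A : 'M[R[i]]_n.+1) :
  reciprocal A -> exists a b : nat -> R[i],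
    (forall i, a i * b i = 1) /\ A = tridiag n.+1 a b.
Proof.
move=> [A0 A1].
(* Padding with 1 beyond the last entry keeps [a i * b i = 1] for every natural [i]. *)
exists (fun i => if (i < n)%N then A (inord i) (inord i.+1) else 1).
exists (fun i => if (i < n)%N then A (inord i.+1) (inord i) else 1).
split=> [i|].
  case: ltnP => [lin|_]; last by rewrite mulr1.
  by apply: A1; rewrite !inordK // ltnS // ltnW.
apply/matrixP => i j; rewrite mxE.
have [ji|ji] := eqVneq (j : nat) i.+1.
  have lin : (i < n)%N by rewrite -ltnS -ji.
  by rewrite lin -ji !inord_val.
have [ij|ij] := eqVneq (i : nat) j.+1; last exact: A0.
have lin : (j < n)%N by rewrite -ltnS -ij.
by rewrite lin -ij !inord_val.
Qed.

Lemma rparam_tridiag (R : realType) (n : nat) (a b : nat -> R[i]) (j : 'I_n) :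
  rparam (tridiag n.+1 a b) j = xi a b j.
Proof.
rewrite /rparam; cbv zeta; rewrite /xi !mxE !lift0 [nat_of_ord (widen_ord _ _)]/=.
by rewrite !eqxx (ltn_eqF (leqnSn j.+1)). 
Qed.

(** As |a i| |b i| = 1, |a i|^2 + |b i|^2 = 2 + 4 [xi a b i]. Hence the determinant of the pencil
    depends on the off-diagonal entries only through the parameters. *)
Lemma offdiag_product (R : realType) (a b : nat -> R[i]) i (z u : R[i]) :
  a i * b i = 1 ->
  (z * a i + u * (b i)^*%R) * (z * b i + u * (a i)^*%R)
  = (z + u) ^+ 2 + 4 * z * u * (xi a b i)%:C.
Proof.
move=> ab.
have nab : Normc.normc (a i) * Normc.normc (b i) = 1.
  by rewrite -Normc.normcM ab Normc.normc1.
have -> : 4 * z * u * (xi a b i)%:C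
   = z * u * ((a i) * (a i)^*%R + b i * (b i)^*%R - 2).
  rewrite !mul_conj_normc /xi.
  have -> : Normc.normc (a i) ^+ 2 =
      2 + 4 * ((Normc.normc (a i) - Normc.normc (b i)) ^+ 2 / 4)
      - Normc.normc (b i) ^+ 2 by lra.
  by rewrite rmorphB rmorphD rmorphM !rmorph_nat /=; ring.
have abc : (a i)^*%R * (b i)^*%R = 1 by rewrite -rmorphM ab rmorph1.
have -> : (z + u) ^+ 2 = z ^+ 2 * (a i * b i) + u ^+ 2 * ((a i)^*%R * (b i)^*%R)
    + 2 * z * u by rewrite ab abc; ring.
ring.
Qed.

Lemma sum_ord5 (V : zmodType) (F : 'I_5 -> V) :
  \sum_i F i = F 0 + (F 1 + (F 2%:R + (F 3%:R + F 4%:R))).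
Proof.
rewrite !big_ord_recl big_ord0 addr0.
by congr (_ + (_ + (_ + (_ + _)))); congr (F _); apply/val_inj.
Qed.

Lemma tridiag5_rowE (R : realType) (a b : nat -> R[i]) (w : R[i])
    (v : 'rV[R[i]]_5) (T := tridiag 5 a b - w%:M) :
  [/\ (v *m T) 0 0 = v 0 1 * b 0%N - w * v 0 0,
      (v *m T) 0 1 = v 0 0 * a 0%N + v 0 2%:R * b 1%N - w * v 0 1,
      (v *m T) 0 2%:R = v 0 1 * a 1%N + v 0 3%:R * b 2%N - w * v 0 2%:R,
      (v *m T) 0 3%:R = v 0 2%:R * a 2%N + v 0 4%:R * b 3%N - w * v 0 3%:R &
      (v *m T) 0 4%:R = v 0 3%:R * a 3%N - w * v 0 4%:R].
Proof.
by split; rewrite /T mxE sum_ord5 !mxE /= ?mulr0n ?mulr1n; ring.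
Qed.

Lemma ord5P (P : 'I_5 -> Prop) :
  P 0 -> P 1 -> P 2%:R -> P 3%:R -> P 4%:R -> forall i, P i.
Proof.
move=> P0 P1 P2 P3 P4 [m mlt].
case: m mlt => [|[|[|[|[|m]]]]] mlt //.
- by rewrite (_ : Ordinal mlt = 0) //; apply/val_inj.
- by rewrite (_ : Ordinal mlt = 1) //; apply/val_inj.
- by rewrite (_ : Ordinal mlt = 2%:R) //; apply/val_inj.
- by rewrite (_ : Ordinal mlt = 3%:R) //; apply/val_inj.
- by rewrite (_ : Ordinal mlt = 4%:R) //; apply/val_inj.
Qed.

Lemma null_vector2 (F : fieldType) (al be ga de : F) :
  al * de = be * ga -> exists x y : F,
    [/\ (x != 0) || (y != 0), al * x + be * y = 0 & ga * x + de * y = 0].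
Proof.
move=> e.
have [al0|al0] := eqVneq al 0; last first.
  exists (- be), al; split; rewrite ?al0 ?orbT //; first by ring.
  by rewrite mulrC mulNr -e; ring.
have [be0|be0] := eqVneq be 0; last first.
  exists (- be), al; split; rewrite ?oppr_eq0 ?be0 //; first by ring.
  by rewrite mulrC mulNr -e; ring.
have [ga0|ga0] := eqVneq ga 0; last first.
  by exists (- de), ga; split; rewrite ?al0 ?be0 ?ga0 ?orbT //; ring.
by exists 1, 0; rewrite al0 be0 ga0 oner_eq0; split=> //; ring.
Qed.

(** Eliminating v_0, v_2, v_4, possible as w is nonzero, leaves a 2 x 2 system in v_1, v_3 that is
    singular by hypothesis. *)
Lemma tridiag5_null_vector (R : realType) (a b : nat -> R[i]) (w : R[i])
    (c := fun i => a i * b i) :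
  w != 0 ->
  (c 0%N + c 1%N - w ^+ 2) * (c 2%N + c 3%N - w ^+ 2) = c 1%N * c 2%N ->
  exists2 v : 'rV[R[i]]_5, v != 0 & v *m (tridiag 5 a b - w%:M) = 0.
Proof.
move=> w0 e.
have [|x [y [xy e1 e2]]] := @null_vector2 R[i] (c 0%N + c 1%N - w ^+ 2)
  (b 1%N * b 2%N) (a 1%N * a 2%N) (c 2%N + c 3%N - w ^+ 2).
  by rewrite e /c; ring.
pose s := [:: x * b 0%N / w; x; (x * a 1%N + y * b 2%N) / w; y; y * a 3%N / w].
pose v : 'rV[R[i]]_5 := \row_j s`_j.
have [E0 E1 E2 E3 E4] := tridiag5_rowE a b w v.
exists v.
  apply/eqP => v0; move: xy; apply/negP; rewrite negb_or !negbK.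
  move/rowP: v0 => v0; move: (v0 1) (v0 3%:R).
  by rewrite !mxE /= => -> ->; rewrite eqxx.
apply/rowP; elim/ord5P; rewrite [RHS]mxE ?(E0, E1, E2, E3, E4) !mxE /=.
- by field.
- rewrite -[RHS](mul0r w^-1) -e1 /c; field; exact: w0.
- by field.
- rewrite -[RHS](mul0r w^-1) -e2 /c; field; exact: w0.
- by field.
Qed.

(** After the same elimination, Cramer's rule gives v_1 = v_3 = 0, and w nonzero gives the rest. *)
Lemma tridiag5_null_vectorP (R : realType) (a b : nat -> R[i]) (w : R[i])
    (v : 'rV[R[i]]_5) (c := fun i => a i * b i) :
  w != 0 -> v *m (tridiag 5 a b - w%:M) = 0 ->
  (c 0%N + c 1%N - w ^+ 2) * (c 2%N + c 3%N - w ^+ 2) != c 1%N * c 2%N -> v = 0.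
Proof.
move=> w0 vT ne.
have [] := tridiag5_rowE a b w v; rewrite vT !mxE => E0 E1 E2 E3 E4.
have d0 : (c 0%N + c 1%N - w ^+ 2) * (c 2%N + c 3%N - w ^+ 2) - c 1%N * c 2%N != 0.
  by rewrite subr_eq0.
have K (x y : R[i]) : y != 0 -> y * x = 0 -> x = 0.
  by move=> y0 /eqP; rewrite mulf_eq0 (negbTE y0) => /eqP.
have F1 : (c 0%N + c 1%N - w ^+ 2) * v 0 1 + b 1%N * b 2%N * v 0 3%:R = 0.
  transitivity (w * (v 0 0 * a 0%N + v 0 2%:R * b 1%N - w * v 0 1)
    + a 0%N * (v 0 1 * b 0%N - w * v 0 0)
    + b 1%N * (v 0 1 * a 1%N + v 0 3%:R * b 2%N - w * v 0 2%:R)); first by rewrite /c; ring.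
  by rewrite -E0 -E1 -E2; ring.
have F3 : a 1%N * a 2%N * v 0 1 + (c 2%N + c 3%N - w ^+ 2) * v 0 3%:R = 0.
  transitivity (w * (v 0 2%:R * a 2%N + v 0 4%:R * b 3%N - w * v 0 3%:R)
    + a 2%N * (v 0 1 * a 1%N + v 0 3%:R * b 2%N - w * v 0 2%:R)
    + b 3%N * (v 0 3%:R * a 3%N - w * v 0 4%:R)); first by rewrite /c; ring.
  by rewrite -E3 -E2 -E4; ring.
have v1 : v 0 1 = 0.
  apply: K d0 _.
  transitivity ((c 2%N + c 3%N - w ^+ 2) *
      ((c 0%N + c 1%N - w ^+ 2) * v 0 1 + b 1%N * b 2%N * v 0 3%:R)
    - b 1%N * b 2%N * (a 1%N * a 2%N * v 0 1 + (c 2%N + c 3%N - w ^+ 2) * v 0 3%:R)).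
    by rewrite /c; ring.
  by rewrite F1 F3; ring.
have v3 : v 0 3%:R = 0.
  apply: K d0 _.
  transitivity ((c 0%N + c 1%N - w ^+ 2) *
      (a 1%N * a 2%N * v 0 1 + (c 2%N + c 3%N - w ^+ 2) * v 0 3%:R)
    - a 1%N * a 2%N * ((c 0%N + c 1%N - w ^+ 2) * v 0 1 + b 1%N * b 2%N * v 0 3%:R)).
    by rewrite /c; ring.
  by rewrite F1 F3; ring.
apply/rowP; elim/ord5P; rewrite mxE //; apply: K w0 _.
- transitivity (v 0 1 * b 0%N); last by rewrite v1 mul0r.
  by apply/eqP; rewrite -subr_eq0 -opprB oppr_eq0 -E0.
- transitivity (v 0 1 * a 1%N + v 0 3%:R * b 2%N); last by rewrite v1 v3; ring.
  by apply/eqP; rewrite -subr_eq0 -opprB oppr_eq0 -E2.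
- transitivity (v 0 3%:R * a 3%N); last by rewrite v3; ring.
  by apply/eqP; rewrite -subr_eq0 -opprB oppr_eq0 -E4.
Qed.

Lemma pencil_tridiag (R : realType) (n : nat) (a b : nat -> R[i])
    (l z u : R[i]) (M := tridiag n a b - l%:M) :
  z *: M + u *: M^t* = tridiag n (fun i => z * a i + u * (b i)^*%R)
    (fun i => z * b i + u * (a i)^*%R) - (z * l + u * l^*%R)%:M.
Proof.
apply/matrixP => i j; rewrite /M !mxE.
have -> : (j == i) = (i == j) by rewrite eq_sym.
have [ji|ji] := eqVneq (j : nat) i.+1.
  have -> : (i == j) = false by rewrite -(inj_eq val_inj) /=; lia.
  have -> : (i == j.+1 :> nat) = false by lia.
  by rewrite !mulr0n !subr0.
have [->|ij] := eqVneq i j.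
  by rewrite (ltn_eqF (ltnSn j)) !mulr1n !sub0r rmorphN /=; ring.
have [ij1|ij1] := eqVneq (i : nat) j.+1; first by rewrite !mulr0n !subr0.
by rewrite !mulr0n subr0 rmorph0; ring.
Qed.

(* With p = v1 M v2^* and q = v1 M^* v2^*, the two null equations read
   z1 p + q = 0 and p + conj z2 q = 0, so p = 0 unless z1 conj z2 = 1. *)
Lemma pencil_null_orthogonal (R : realType) (n : nat) (M : 'M[R[i]]_n)
    (v1 v2 : 'rV[R[i]]_n) (z1 z2 : R[i]) :
  v1 *m (z1 *: M + M^t*) = 0 -> v2 *m (z2 *: M + M^t*) = 0 ->
  z1 * z2^*%R != 1 -> v1 *m M *m v2^t* = 0.
Proof.
move=> e1 e2 z12.
have f1 : z1 *: (v1 *m M *m v2^t*) + v1 *m M^t* *m v2^t* = 0.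
  by rewrite scalemxAl -mulmxDl scalemxAr -mulmxDr e1 mul0mx.
have f2 : z2^*%R *: (v1 *m M^t* *m v2^t*) + v1 *m M *m v2^t* = 0.
  have : ((v2 *m (z2 *: M + M^t*)) *m v1^t*)^t* = 0.
    by rewrite e2 mul0mx trmx0 map_mx0.
  rewrite mulmxDr mulmxDl raddfD /= map_mxD !trCmxM !trmxCK mulmxA => <-.
  by rewrite linearZ /= map_mxZ -scalemxAr -scalemxAl !mulmxA.
have : (1 - z1 * z2^*%R) *: (v1 *m M *m v2^t*) = 0.
  move: f1 f2; move: (v1 *m M *m v2^t*) (v1 *m M^t* *m v2^t*) => P Q /eqP.
  rewrite addrC addr_eq0 => /eqP -> <-.
  by rewrite scalerBl scale1r scalerN scalerA mulrC addrC.
move/eqP; rewrite scaler_eq0 subr_eq0 eq_sym (negbTE z12) => /eqP.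
exact.
Qed.

(* The hypothesis on z3 excludes a common null vector of M and M^*, hence the case
   of parallel v1 and v2. *)
Lemma pencil_isotropic (R : realType) (n : nat) (M : 'M[R[i]]_n)
    (v1 v2 : 'rV[R[i]]_n) (z1 z2 z3 : R[i]) :
  v1 != 0 -> v2 != 0 ->
  v1 *m (z1 *: M + M^t*) = 0 -> v2 *m (z2 *: M + M^t*) = 0 ->
  Normc.normc z1 < 1 -> Normc.normc z2 < 1 -> z1 != z2 ->
  (forall v : 'rV_n, v *m (z3 *: M + M^t*) = 0 -> v = 0) ->
  exists X : 'M[R[i]]_(1 + 1, n), row_free X /\ X *m M *m X^t* = 0.
Proof.
move=> v10 v20 e1 e2 z11 z21 z12 h3.
have lt1 x y : Normc.normc x < 1 -> Normc.normc y < 1 -> x * y^*%R != 1 :> R[i].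
  move=> x1 y1; apply/eqP => /(congr1 (@Normc.normc R)).
  rewrite Normc.normc1 Normc.normcM.
  rewrite normc_conj.
  by move: (normc_ge0 x) (normc_ge0 y) => x0 y0; nra.
exists (col_mx v1 v2); split; last first.
  rewrite tr_col_mx map_row_mx mul_col_mx mul_col_mx !mul_mx_row.
  rewrite (pencil_null_orthogonal e1 e1) ?lt1 //.
  rewrite (pencil_null_orthogonal e1 e2) ?lt1 //.
  rewrite (pencil_null_orthogonal e2 e1) ?lt1 //.
  by rewrite (pencil_null_orthogonal e2 e2) ?lt1 // row_mx0 col_mx0.
apply: inj_row_free => u; rewrite -[u]hsubmxK mul_row_col.
rewrite [lsubmx u]mx11_scalar [rsubmx u]mx11_scalar !mul_scalar_mx.
move: (lsubmx u 0 0) (rsubmx u 0 0) => s t st.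
have t0 : t = 0.
  apply/eqP; apply/negPn/negP => tn; move/negP: v20; apply; apply/eqP.
  have e21 : v2 *m (z1 *: M + M^t*) = 0.
    have := congr1 (fun v => v *m (z1 *: M + M^t*)) st.
    rewrite /= mulmxDl -!scalemxAl e1 scaler0 add0r mul0mx => /eqP.
    by rewrite scaler_eq0 (negbTE tn) => /eqP.
  have vM : v2 *m M = 0.
    have /eqP : (z1 - z2) *: (v2 *m M) = 0.
      rewrite scalerBl !scalemxAr -mulmxBr.
      have -> : z1 *: M - z2 *: M = (z1 *: M + M^t*) - (z2 *: M + M^t*).
        by rewrite opprD addrACA subrr addr0.
      by rewrite mulmxBr e21 e2 subrr.
    by rewrite scaler_eq0 subr_eq0 (negbTE z12) => /eqP.
  apply: h3; move: e2; rewrite !mulmxDr -!scalemxAr vM !scaler0 !add0r.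
  by [].
move: st; rewrite t0 scale0r addr0 => /eqP.
rewrite scaler_eq0 (negbTE v10) orbF => /eqP ->.
by rewrite !raddf0 row_mx0.
Qed.

(** For a 5 x 5 reciprocal A with parameters [x], the determinant of z (A - l) + (A - l)^* is - w
    times this value; [c] comes from [offdiag_product] at u = 1. *)
Definition pencil_poly (R : realType) (x : nat -> R) (l z : R[i]) : R[i] :=
  let w := z * l + l^*%R in
  let c i := (z + 1) ^+ 2 + 4 * z * (x i)%:C in
  (c 0%N + c 1%N - w ^+ 2) * (c 2%N + c 3%N - w ^+ 2) - c 1%N * c 2%N.

Lemma pencil_poly_offdiag (R : realType) (a b : nat -> R[i]) (l z : R[i])
    (w := z * l + l^*%R)
    (c := fun i => (z * a i + (b i)^*%R) * (z * b i + (a i)^*%R)) :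
  (forall i, a i * b i = 1) -> pencil_poly (xi a b) l z =
  (c 0%N + c 1%N - w ^+ 2) * (c 2%N + c 3%N - w ^+ 2) - c 1%N * c 2%N.
Proof.
move=> ab.
have E i : c i = (z + 1) ^+ 2 + 4 * z * (xi a b i)%:C.
  rewrite -[4 * z]mulr1 -(offdiag_product z 1 (ab i)) /c.
  by rewrite !mul1r.
by rewrite /pencil_poly !E.
Qed.

Lemma pencil_tridiag1 (R : realType) (n : nat) (a b : nat -> R[i])
    (l z : R[i]) (M := tridiag n a b - l%:M) :
  z *: M + M^t* = tridiag n (fun i => z * a i + (b i)^*%R)
    (fun i => z * b i + (a i)^*%R) - (z * l + l^*%R)%:M.
Proof.
rewrite -[M^t*]scale1r pencil_tridiag mul1r; congr (_ - _).
by apply/matrixP => i j; rewrite !mxE !mul1r.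
Qed.

Lemma rank_numrange_tridiag5_roots (R : realType) (a b : nat -> R[i])
    (l z1 z2 z3 : R[i]) :
  (forall i, a i * b i = 1) -> l != 0 ->
  Normc.normc z1 < 1 -> Normc.normc z2 < 1 -> z1 != z2 ->
  pencil_poly (xi a b) l z1 = 0 -> pencil_poly (xi a b) l z2 = 0 ->
  z3 * l + l^*%R != 0 -> pencil_poly (xi a b) l z3 != 0 ->
  rank_numrange 2 (tridiag 5 a b) l.
Proof.
move=> ab l0 z11 z21 z12 p1 p2 w3 p3.
have nullv z : Normc.normc z < 1 -> pencil_poly (xi a b) l z = 0 ->
    exists2 v : 'rV_5, v != 0 &
      v *m (z *: (tridiag 5 a b - l%:M) + (tridiag 5 a b - l%:M)^t*) = 0.
  move=> z1' pz; rewrite pencil_tridiag1; apply: tridiag5_null_vector.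
    (* On the open disk |z l| < |l|, so z l + conj l is nonzero. *)
    apply/eqP => /eqP; rewrite addr_eq0 => /eqP /(congr1 (@Normc.normc R)).
    rewrite normcN Normc.normcM.
    rewrite normc_conj.
    have : 0 < Normc.normc l.
      rewrite lt_def normc_ge0 andbT; apply/eqP => /Normc.eq0_normc /eqP.
      by rewrite (negbTE l0).
    by nra.
  by apply/eqP; rewrite -subr_eq0 -pencil_poly_offdiag // pz.
have [v1 v10 e1] := nullv z1 z11 p1.
have [v2 v20 e2] := nullv z2 z21 p2.
have [v|X [Xf XM]] := pencil_isotropic v10 v20 e1 e2 z11 z21 z12 (z3 := z3).
  rewrite pencil_tridiag1 => /tridiag5_null_vectorP; apply=> //.
  by rewrite -subr_eq0 -pencil_poly_offdiag.
exact: rank_numrange_isotropic XM.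
Qed.

(** The basis vectors of index 1 and 3 are not adjacent, so they span an isotropic plane. The point
    0 is treated apart because there z l + conj l vanishes for every z. *)
Lemma rank_numrange_tridiag5_0 (R : realType) (a b : nat -> R[i]) :
  rank_numrange 2 (tridiag 5 a b) 0.
Proof.
pose X : 'M[R[i]]_(2, 5) := \matrix_(i, j) (j == (2 * i).+1 :> nat)%:R.
apply: (@rank_numrange_isotropic _ _ _ _ X).
  apply/row_freeP; exists X^T; apply/matrixP => i j.
  rewrite !mxE sum_ord5 !mxE /=.
  by case: i j => [[|[|[]]] // ?] [[|[|[]]] // ?];
    rewrite -(inj_eq val_inj) /= !(mul0r, mulr0, mulr1, addr0, add0r).
apply/matrixP => i j; rewrite !mxE sum_ord5 !mxE !sum_ord5 !mxE /=.
by case: i j => [[|[|[]]] // ?] [[|[|[]]] // ?];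
  rewrite /= !(mulr0n, mulr1n, rmorph0, rmorph1) ; ring.
Qed.

(** Primed variables stand for conjugates. After multiplication by w, completing squares in v0, v2,
    v4 leaves the Schur complement form in v1, v3. *)
Lemma complete_squares5 (C : comRingType)
    (v0 v1 v2 v3 v4 v0' v1' v2' v3' v4' : C)
    (p0 p1 p2 p3 p0' p1' p2' p3' w : C) :
  (w * v0 - v1 * p0') * (w * v0' - v1' * p0)
  + (w * v2 - (v1 * p1 + v3 * p2')) * (w * v2' - (v1' * p1' + v3' * p2))
  + (w * v4 - v3 * p3) * (w * v4' - v3' * p3')
  + w * ((v1 * p0' - w * v0) * v0' + (v0 * p0 + v2 * p1' - w * v1) * v1'
     + (v1 * p1 + v3 * p2' - w * v2) * v2'
     + (v2 * p2 + v4 * p3' - w * v3) * v3' + (v3 * p3 - w * v4) * v4')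
  = (p0 * p0' + p1 * p1' - w ^+ 2) * (v1 * v1')
    + (p1 * p2 * v1 * v3' + p1' * p2' * v1' * v3)
    + (p2 * p2' + p3 * p3' - w ^+ 2) * (v3 * v3').
Proof. ring. Qed.

(** By [complete_squares5] the Schur form is a sum of three squared moduli at an isotropic vector.
    If v_1 = v_3 = 0, that sum is 0 and so are w v_0, w v_2, w v_4. *)
Lemma isotropic_form_ge0 (R : realType) (p : nat -> R[i]) (w : R)
    (v : 'rV[R[i]]_5) (c := fun i => Normc.normc (p i) ^+ 2) :
  w != 0 -> v != 0 ->
  v *m (tridiag 5 p (fun i => (p i)^*%R) - w%:C%:M) *m v^t* = 0 ->
  (v 0 1 != 0) || (v 0 3%:R != 0) /\
  0 <= (c 0%N + c 1%N - w ^+ 2) * Normc.normc (v 0 1) ^+ 2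
   + 2 * complex.Re (p 1%N * p 2%N * v 0 1 * (v 0 3%:R)^*%R)
   + (c 2%N + c 3%N - w ^+ 2) * Normc.normc (v 0 3%:R) ^+ 2.
Proof.
move=> w0 v0 vT.
set f := (X in 0 <= X).
have [E0 E1 E2 E3 E4] := tridiag5_rowE p (fun i => (p i)^*%R) w%:C v.
have wC : (w%:C)^*%R = w%:C by exact: conjc_real.
pose r0 := w%:C * v 0 0 - v 0 1 * (p 0%N)^*%R.
pose r2 := w%:C * v 0 2%:R - (v 0 1 * p 1%N + v 0 3%:R * (p 2%N)^*%R).
pose r4 := w%:C * v 0 4%:R - v 0 3%:R * p 3%N.
have sq : Normc.normc r0 ^+ 2 + Normc.normc r2 ^+ 2 + Normc.normc r4 ^+ 2 = f.
  apply: (@complexI R).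
  have eRe : (2 * complex.Re (p 1%N * p 2%N * v 0 1 * (v 0 3%:R)^*%R))%:C
    = p 1%N * p 2%N * v 0 1 * (v 0 3%:R)^*%R
      + (p 1%N)^*%R * (p 2%N)^*%R * (v 0 1)^*%R * v 0 3%:R.
    rewrite rmorphM rmorph_nat -(addcJ (_ * _)); congr (_ + _).
    have -> (z : R[i]) : (z^*)%C = z^*%R by [].
    by rewrite !rmorphM /= conjCK.
  have D2 (x y u : R) : (x * y + u)%:C = x%:C * y%:C + u%:C.
    by rewrite rmorphD rmorphM.
  have D1 (x y u : R) : (x + y * u)%:C = x%:C + y%:C * u%:C.
    by rewrite rmorphD rmorphM.
  have D3 (x y u : R) : (x + y - u ^+ 2)%:C = x%:C + y%:C - u%:C ^+ 2.
    by rewrite rmorphB rmorphD rmorphXn.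
  have D4 (x y u : R) : (x + y + u)%:C = x%:C + y%:C + u%:C by rewrite !rmorphD.
  rewrite D4 [f%:C]D1 [(_ + 2 * _)%:C]D2 eRe !D3 /c -!mul_conj_normc.
  have cs := complete_squares5 (v 0 0) (v 0 1) (v 0 2%:R) (v 0 3%:R) (v 0 4%:R)
    (v 0 0)^*%R (v 0 1)^*%R (v 0 2%:R)^*%R (v 0 3%:R)^*%R (v 0 4%:R)^*%R
    (p 0%N) (p 1%N) (p 2%N) (p 3%N)
    (p 0%N)^*%R (p 1%N)^*%R (p 2%N)^*%R (p 3%N)^*%R w%:C.
  rewrite -cs.
  move/matrixP: vT => /(_ 0 0).
  rewrite mxE sum_ord5 E0 E1 E2 E3 E4 !mxE => vT.
  rewrite -[LHS]addr0 -(mulr0 w%:C) -vT /r0 /r2 /r4.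
  have conjB (x y : R[i]) : (x - y)^*%R = x^*%R - y^*%R by rewrite rmorphB.
  have conjD (x y : R[i]) : (x + y)^*%R = x^*%R + y^*%R by rewrite rmorphD.
  have conjM (x y : R[i]) : (x * y)^*%R = x^*%R * y^*%R by rewrite rmorphM.
  rewrite !conjB !conjD !conjM wC !conjCK.
  by ring.
split; last by rewrite -sq !addr_ge0 ?sqr_ge0.
apply/negPn/negP; rewrite negb_or !negbK => /andP[/eqP v1 /eqP v3].
have f0 : f = 0 by rewrite /f v1 v3 Normc.normc0 !mulr0 mul0r /=; ring.
have := normc_ge0 r0; have := normc_ge0 r2; have := normc_ge0 r4.
rewrite f0 in sq => n4 n2 n0.
have wn x : Normc.normc (w%:C * x) ^+ 2 = 0 -> x = 0.
  move/eqP; rewrite sqrf_eq0 => /eqP /Normc.eq0_normc /eqP.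
  rewrite mulf_eq0 -(rmorph0 (real_complex R)) (inj_eq (@complexI R)).
  by rewrite (negbTE w0) => /eqP.
have s4 := sqr_ge0 (Normc.normc r4); have s2 := sqr_ge0 (Normc.normc r2).
have s0 := sqr_ge0 (Normc.normc r0).
move/eqP: v0; apply; apply/rowP; elim/ord5P; rewrite mxE //; apply: wn.
- by rewrite [w%:C * _](_ : _ = r0); [lra|rewrite /r0 v1; ring].
- by rewrite [w%:C * _](_ : _ = r2); [lra|rewrite /r2 v1 v3; ring].
- by rewrite [w%:C * _](_ : _ = r4); [lra|rewrite /r4 v3; ring].
Qed.

(* The Hermitian matrix G = z M + (z M)^*, with M = A - l, vanishes on a
   2-dimensional subspace, so it has no negative definite (when w > 0)
   4-dimensional subspace; G is bipartite up to the scalar w, which makes its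
   inertia that of a 2 x 2 Schur complement. *)
Lemma rank_numrange_tridiag5_psd (R : realType) (a b : nat -> R[i])
    (l z : R[i]) (w : R)
    (c := fun i => Normc.normc (z * a i + (z * b i)^*%R) ^+ 2) :
  rank_numrange 2 (tridiag 5 a b) l -> w%:C = z * l + (z * l)^*%R ->
  [/\ 0 <= c 0%N + c 1%N - w ^+ 2, 0 <= c 2%N + c 3%N - w ^+ 2 &
      c 1%N * c 2%N <= (c 0%N + c 1%N - w ^+ 2) * (c 2%N + c 3%N - w ^+ 2)].
Proof.
move=> Al wE.
have c0 i : 0 <= c i by exact: sqr_ge0.
have [w0|w0] := eqVneq w 0.
  rewrite w0 expr0n /= !subr0; split; rewrite ?addr_ge0 //.
  by move: (c0 0%N) (c0 1%N) (c0 2%N) (c0 3%N) => ? ? ? ?; nra.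
pose p i := z * a i + (z * b i)^*%R.
apply: contrapT => H.
have [|x [y xy]] := @hermitian_form_neg R (c 0%N + c 1%N - w ^+ 2)
    (c 2%N + c 3%N - w ^+ 2) (p 1%N * p 2%N).
  by rewrite Normc.normcM exprMn; exact: H.
(* v B = 0 forces (v_1, v_3) to be a multiple of (x, y), where the Schur form is negative. *)
pose B : 'cV[R[i]]_5 := \col_i (if i == 1 then y else if i == 3%:R then - x else 0).
have [v [v0 vB vM]] := rank_numrange_vector B (isT : (1 < 2)%N) Al.
have vxy : v 0 1 * y = v 0 3%:R * x.
  move/matrixP: vB => /(_ 0 0); rewrite mxE sum_ord5 !mxE /= => e.
  by apply/eqP; rewrite -subr_eq0 -e; apply/eqP; ring.
have vT : v *m (tridiag 5 p (fun i => (p i)^*%R) - w%:C%:M) *m v^t* = 0.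
  have -> : tridiag 5 p (fun i => (p i)^*%R) - w%:C%:M
     = z *: (tridiag 5 a b - l%:M) + z^*%R *: (tridiag 5 a b - l%:M)^t*.
    rewrite pencil_tridiag wE rmorphM; congr (_ - _).
    apply/matrixP => i j; rewrite !mxE /p.
    by rewrite !rmorphD !rmorphM /= !conjCK [_ * b j + _]addrC.
  rewrite mulmxDr mulmxDl -!scalemxAr -!scalemxAl vM scaler0 add0r.
  rewrite [_ *m _ *m _](_ : _ = (v *m (tridiag 5 a b - l%:M) *m v^t*)^t*).
    by rewrite vM trmx0 map_mx0 scaler0.
  by rewrite !trCmxM trmxCK mulmxA.
have [vn0 f0] := isotropic_form_ge0 w0 v0 vT.
have [t [t1 t3]] : exists t, v 0 1 = t * x /\ v 0 3%:R = t * y.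
  have [x0|x0] := eqVneq x 0; last first.
    exists (v 0 1 / x); split; first by field.
    by rewrite mulrAC vxy; field.
  have [y0|y0] := eqVneq y 0.
    by move: xy; rewrite x0 y0 Normc.normc0 !mulr0 mul0r /=; lra.
  exists (v 0 3%:R / y); split; last by field.
  by rewrite mulrAC -vxy; field.
have t0 : t != 0.
  by apply/eqP => t0; move: vn0; rewrite t1 t3 t0 !mul0r eqxx.
have tp : 0 < Normc.normc t ^+ 2.
  rewrite exprn_gt0 // lt_def normc_ge0 andbT.
  by apply/eqP => /Normc.eq0_normc /eqP; rewrite (negbTE t0).
move: f0; apply/negP; rewrite -ltNge -/p t1 t3.
rewrite [X in complex.Re X](_ : _ =
   (Normc.normc t ^+ 2)%:C * (p 1%N * p 2%N * x * y^*%R)); last first.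
  by rewrite -mul_conj_normc rmorphM /=; ring.
have -> (s : R) (q : R[i]) : complex.Re (s%:C * q) = s * complex.Re q.
  by case: q => q1 q2 /=; ring.
rewrite !Normc.normcM !exprMn.
rewrite [X in X < 0](_ : _ = Normc.normc t ^+ 2 *
  ((c 0%N + c 1%N - w ^+ 2) * Normc.normc x ^+ 2
   + 2 * complex.Re (p 1%N * p 2%N * x * y^*%R)
   + (c 2%N + c 3%N - w ^+ 2) * Normc.normc y ^+ 2)); last by rewrite /c /p; ring.
by rewrite pmulr_rlt0.
Qed.

(** * Ellipses *)

(** The real quadratic form k (Re z)^2 + be |z|^2 - (Re (z u))^2 has eigenvalues with sum k + 2 be -
    |u|^2 and difference |u^2 - k|, so the hypothesis makes the smaller one negative. *)
Lemma elliptical_disk_support (R : realType) (u : R[i]) (k be : R) :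
  k + 2 * be - Normc.normc u ^+ 2 < Normc.normc (u ^+ 2 - k%:C) ->
  exists z : R[i], k * complex.Re z ^+ 2 + be * Normc.normc z ^+ 2
                   < complex.Re (z * u) ^+ 2.
Proof.
case: u => p q h.
have [|x [y xy]] := @quadratic_form_neg R (k + be - p ^+ 2) (- (p * q)) (be - q ^+ 2).
  move=> [h1 h2 h3]; move: h; apply/negP; rewrite -leNgt.
  rewrite -(ler_pXn2r (n := 2)) ?nnegrE ?normc_ge0 //; last first.
    by rewrite normc_sqr /=; lra.
  by rewrite !normc_sqr /=; nra.
by exists (x -i* y); rewrite normc_sqr /=; lra.
Qed.

Lemma offdiag_normc (R : realType) (a b : nat -> R[i]) i (z : R[i]) :
  a i * b i = 1 ->
  Normc.normc (z * a i + (z * b i)^*%R) ^+ 2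
  = 4 * (complex.Re z ^+ 2 + Normc.normc z ^+ 2 * xi a b i).
Proof.
move=> ab; apply: (@complexI R); rewrite -mul_conj_normc.
have -> : (z * a i + (z * b i)^*%R) * (z * a i + (z * b i)^*%R)^*%R
   = (z * a i + z^*%R * (b i)^*%R) * (z * b i + z^*%R * (a i)^*%R).
  by rewrite !rmorphD !rmorphM /= !conjCK; ring.
rewrite offdiag_product //.
have -> : z + z^*%R = 2 * (complex.Re z)%:C by exact: addcJ.
have -> : 4 * z * z^*%R * (xi a b i)%:C = 4 * (z * z^*%R) * (xi a b i)%:C.
  by ring.
by rewrite mul_conj_normc; ring.
Qed.

(** [Z1], [Z2] are the eigenvalues of the Schur complement at w = 0, up to a factor 4. By
    [rank_numrange_tridiag5_psd], Z1 - w^2 and Z2 - w^2 have nonnegative sum and product. *)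
Lemma rank_numrange_tridiag5_bound (R : realType) (a b : nat -> R[i])
    (l z : R[i]) (w Z1 Z2 : R)
    (c := fun i => complex.Re z ^+ 2 + Normc.normc z ^+ 2 * xi a b i) :
  (forall i, a i * b i = 1) ->
  rank_numrange 2 (tridiag 5 a b) l -> w = complex.Re (z * l) ->
  Z1 + Z2 = c 0%N + c 1%N + c 2%N + c 3%N ->
  Z1 * Z2 = (c 0%N + c 1%N) * (c 2%N + c 3%N) - c 1%N * c 2%N ->
  w ^+ 2 <= Z2.
Proof.
move=> ab Al wE sZ pZ.
have [|] := @rank_numrange_tridiag5_psd R a b l z (2 * w) Al.
  by rewrite wE rmorphM rmorph_nat; exact/esym/addcJ.
rewrite !offdiag_normc // -!/(c _).
move: (c 0%N) (c 1%N) (c 2%N) (c 3%N) sZ pZ => c0 c1 c2 c3 sZ pZ h1 h2 h3.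
rewrite leNgt; apply/negP => lt.
have : 0 <= (Z1 - w ^+ 2) * (Z2 - w ^+ 2).
  rewrite (_ : _ * _ = (Z1 * Z2) - (Z1 + Z2) * w ^+ 2 + w ^+ 2 * w ^+ 2).
    by rewrite pZ sZ; lra.
  by ring.
rewrite nmulr_lge0; last by lra.
lra.
Qed.

(* In terms of A - l, the condition det = 0 on the pencil factors into two such
   quadratics; each one has roots of modulus 1 exactly when l is outside the
   open ellipse with centre al, focal half-distance sqrt k and minor half-axis
   sqrt be. *)
Definition ellipse_poly (R : realType) (al k be : R) (l z : R[i]) : R[i] :=
  (z * l + l^*%R - al%:C * (1 + z)) ^+ 2 - k%:C * (1 + z) ^+ 2 - 4 * z * be%:C.

(** Strict form of the inequality in [elliptical_diskE], with [k] for the squared focal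
    half-distance and d^2 = 4 be. *)
Definition ellipse_interior (R : realType) (al k be : R) (l : R[i]) : Prop :=
  Normc.normc ((l - al%:C) ^+ 2 - k%:C)
  < k + 2 * be - Normc.normc (l - al%:C) ^+ 2.

(** [ellipse_poly] is a z^2 - 2 d z + conj a with a = (l - al)^2 - k and d = k + 2 be - |l - al|^2,
    and the hypothesis is |a| < d. *)
Lemma ellipse_poly_root (R : realType) (al k be : R) (l : R[i]) :
  ellipse_interior al k be l ->
  exists z, Normc.normc z < 1 /\ ellipse_poly al k be l z = 0.
Proof.
move=> /self_inversive_root [z [z1 e]]; exists z; split=> //; rewrite -e.
rewrite rmorphB rmorphD rmorphM rmorph_nat /= -mul_conj_normc.
have cr (x : R) : (x%:C)^*%R = x%:C by exact: conjc_real.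
by rewrite /ellipse_poly !rmorphB !rmorphXn !rmorphB /= !cr; ring.
Qed.

Lemma ellipse_poly0_real (R : realType) (al k be : R) (l : R[i]) :
  0 <= k -> ellipse_poly al k be l 0 = 0 -> l = (complex.Re l)%:C.
Proof.
move=> k0; case: l => p q.
rewrite /ellipse_poly => /eqP; rewrite eq_complex /= => /andP[/eqP e1 /eqP e2].
suff -> : q = 0 by [].
have h1 : (p - al) * q = 0 by lra.
have h2 : (p - al) ^+ 2 - q ^+ 2 = k by lra.
move/eqP: h1; rewrite mulf_eq0 => /orP[/eqP e|/eqP //].
by move: h2; rewrite e; nra.
Qed.

Lemma ellipse_poly1_real (R : realType) (al k be p : R) :
  ellipse_interior al k be p%:C -> ellipse_poly al k be p%:C 1 != 0.
Proof.
rewrite /ellipse_interior.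
have -> : (p%:C - al%:C) ^+ 2 - k%:C = ((p - al) ^+ 2 - k)%:C :> R[i] by ring.
have -> : p%:C - al%:C = (p - al)%:C :> R[i] by ring.
rewrite !normc_real.
rewrite real_normK ?num_real // => h.
apply/eqP; rewrite /ellipse_poly => /eqP.
rewrite eq_complex /= => /andP[/eqP e1 _].
have e : (p - al) ^+ 2 = k + be by lra.
move: h; rewrite e (_ : k + be - k = be); last by ring.
by rewrite (_ : k + 2 * be - (k + be) = be) ?ltNge ?ler_norm //; ring.
Qed.

Lemma rank_numrange_tridiag5_interior (R : realType) (a b : nat -> R[i])
    (al1 k1 be1 al2 k2 be2 : R) (l : R[i]) :
  (forall i, a i * b i = 1) -> l != 0 -> 0 <= k1 -> 0 <= k2 ->
  (forall z, pencil_poly (xi a b) l z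
     = ellipse_poly al1 k1 be1 l z * ellipse_poly al2 k2 be2 l z) ->
  ellipse_interior al1 k1 be1 l -> ellipse_interior al2 k2 be2 l ->
  (forall z, Normc.normc z < 1 -> ellipse_poly al1 k1 be1 l z = 0 ->
     ellipse_poly al2 k2 be2 l z = 0 -> False) ->
  rank_numrange 2 (tridiag 5 a b) l.
Proof.
move=> ab l0 k10 k20 fac i1 i2 sep.
have [z1 [z11 e1]] := ellipse_poly_root i1.
have [z2 [z21 e2]] := ellipse_poly_root i2.
have z12 : z1 != z2.
  by apply/eqP => z12; apply: (sep z1) => //; rewrite z12.
have p1 : pencil_poly (xi a b) l z1 = 0 by rewrite fac e1 mul0r.
have p2 : pencil_poly (xi a b) l z2 = 0 by rewrite fac e2 mulr0.
have main z3 := @rank_numrange_tridiag5_roots R a b l z1 z2 z3 ab l0 z11 z21 z12 p1 p2.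
(* The pencil is nonsingular at z = 0 unless 0 is a root, which forces [l] to be real; then z = 1
   serves, with w = 2 l. *)
have [p0|p0] := eqVneq (pencil_poly (xi a b) l 0) 0; last first.
  by apply: (main 0) => //; rewrite mul0r add0r conjC_eq0.
have lr : l = (complex.Re l)%:C.
  move/eqP: p0; rewrite fac mulf_eq0 => /orP[] /eqP; exact: ellipse_poly0_real.
apply: (main 1).
  rewrite mul1r lr [(_%:C)^*%R]conjc_real -lr -mulr2n mulrn_eq0 /=.
  exact: l0.
by rewrite fac mulf_neq0 // lr ellipse_poly1_real // -lr.
Qed.

(** [be] and [t] are half the sum and half the difference of x_0 and x_3. Both sides are quadratic
    in w^2, and they agree exactly when t (x_2 - x_1 - t) = 0, which is hypothesis (a). *)
Lemma pencil_poly_factor_sym (R : realType) (x : nat -> R) (be t : R) (l z : R[i]) :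
  x 0%N = be + t -> x 3%N = be - t -> t = 0 \/ t = x 2%N - x 1%N ->
  pencil_poly x l z = ellipse_poly 0 1 be l z
    * ellipse_poly 0 3 (be + x 1%N + x 2%N) l z.
Proof.
rewrite /pencil_poly /ellipse_poly => -> -> [] ->; ring.
Qed.

(** The foci al + k, al - k are s, -1. As a polynomial in w = z l + conj l the left side is even,
    and w -> - w swaps the two factors. *)
Lemma pencil_poly_factor_shift (R : realType) (x : nat -> R) (s : R) (l z : R[i])
    (al := (s - 1) / 2) (k := (s + 1) / 2) (y := x 1%N + x 2%N) :
  s ^+ 2 = 3 -> x 1%N * x 2%N = 0 ->
  x 0%N = s / 2 * y + x 2%N -> x 3%N = s / 2 * y + x 1%N ->
  pencil_poly x l z = ellipse_poly al (k ^+ 2) (k ^+ 2 * y) l z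
    * ellipse_poly (- al) (k ^+ 2) (k ^+ 2 * y) l z.
Proof.
move=> s2 xx e0 e3.
have sC : s%:C ^+ 2 = 3 :> R[i] by rewrite -rmorphXn s2 rmorph_nat.
rewrite /pencil_poly /ellipse_poly e0 e3 /al /k /y.
move/eqP: xx; rewrite mulf_eq0 => /orP[] /eqP ->.
  by field: sC.
by field: sC.
Qed.

(** * Perturbation of the parameters *)

Lemma near_right_avoid (R : realType) (P : R -> Prop) :
  (forall e e', P e -> P e' -> e = e') -> \forall e \near 0^'+, ~ P e.
Proof.
move=> uniqP.
have [[e0 [e00 Pe0]]|nP] := pselect (exists e, 0 < e /\ P e).
  near=> e => Pe; have : e < e0 by near: e; exact: nbhs_right_lt.
  by rewrite (uniqP _ _ Pe Pe0) ltxx.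
by near=> e => Pe; apply: nP; exists e; split=> //; near: e; exact: nbhs_right_gt.
Unshelve. all: by end_near.
Qed.

Lemma ccvg_real (R : realType) (T : Type) (F : set_system T) (f : T -> R) (l : R) :
  ProperFilter F -> f t @[t --> F] --> l -> ccvg F (fun t => (f t)%:C) l%:C.
Proof. by move=> FF fl; split=> //; exact: cvg_cst. Qed.

(* With g = sqrt x + sqrt (1 + x) the moduli g and 1/g have parameter x. *)
Lemma reciprocal_pair_perturb (R : realType) (a b : R[i]) (d : R) :
  a * b = 1 -> 0 <= d ->
  exists f : R -> R[i] * R[i],
    [/\ forall e, 0 <= e -> (f e).1 * (f e).2 = 1 /\
          (Normc.normc (f e).1 - Normc.normc (f e).2) ^+ 2 / 4
          = (Normc.normc a - Normc.normc b) ^+ 2 / 4 + e * d,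
        ccvg 0^'+ (fun e => (f e).1) a & ccvg 0^'+ (fun e => (f e).2) b].
Proof.
wlog ab : a b / Normc.normc b <= Normc.normc a.
  move=> H ab1 d0.
  have [ab|/ltW ba] := leP (Normc.normc b) (Normc.normc a); first exact: H.
  have [//||//|f [h1 h2 h3]] := H b a; first by rewrite mulrC.
  exists (fun e => ((f e).2, (f e).1)); split=> // e e0; have [g1 g2] := h1 e e0.
  by rewrite /= mulrC -(sqrrN (_ - _)) opprB g2 -(sqrrN (_ - _)) opprB.
move=> ab1 d0.
have nab : Normc.normc a * Normc.normc b = 1.
  by rewrite -Normc.normcM ab1 Normc.normc1.
move: (normc_ge0 a) (normc_ge0 b).
move E : (Normc.normc a) => r; move E' : (Normc.normc b) => r'.
rewrite E E' in ab nab * => r0 r'0.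
pose x0 := (r - r') ^+ 2 / 4.
have x00 : 0 <= x0 by rewrite mulr_ge0 ?sqr_ge0 // invr_ge0.
(* As r r' = 1, the new moduli r * g e and r' * h e are sqrt (1 + x) + sqrt x and sqrt (1 + x) -
   sqrt x at x = x0 + e * d; phases are kept. *)
pose g e : R := r' * (Num.sqrt (1 + (x0 + e * d)) + Num.sqrt (x0 + e * d)).
pose h e : R := r * (Num.sqrt (1 + (x0 + e * d)) - Num.sqrt (x0 + e * d)).
have s0 : Num.sqrt x0 = (r - r') / 2.
  rewrite (_ : x0 = ((r - r') / 2) ^+ 2); last by rewrite /x0; field.
  by rewrite sqrtr_sqr ger0_norm //; lra.
have s1 : Num.sqrt (1 + x0) = (r + r') / 2.
  rewrite (_ : 1 + x0 = ((r + r') / 2) ^+ 2).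
    by rewrite sqrtr_sqr ger0_norm //; lra.
  by rewrite -[X in X + _]nab /x0; field.
have sqrt_cvg c : Num.sqrt (c + (x0 + e * d)) @[e --> 0^'+] --> Num.sqrt (c + x0).
  apply: continuous_cvg; first exact: sqrt_continuous.
  apply: cvgD; first exact: cvg_cst.
  rewrite -[X in _ --> X]addr0 -[X in _ --> _ + X](mul0r d).
  apply: cvgD; first exact: cvg_cst.
  have e0 : (e : R) @[e --> (0 : R)^'+] --> (0 : R) by exact: cvg_within.
  exact: (cvgM e0 (cvg_cst d)).
have cg : g e @[e --> 0^'+] --> (1 : R).
  rewrite (_ : 1 = r' * (Num.sqrt (1 + x0) + Num.sqrt (0 + x0))); last first.
    by rewrite add0r s0 s1 -[LHS]nab; field.
  apply: cvgM; first exact: cvg_cst.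
  apply: cvgD; first exact: sqrt_cvg.
  have := sqrt_cvg 0; rewrite (_ : (fun e => _) = fun e => Num.sqrt (x0 + e * d)) //.
  by apply/funext => e; rewrite add0r.
have ch : h e @[e --> 0^'+] --> (1 : R).
  rewrite (_ : 1 = r * (Num.sqrt (1 + x0) - Num.sqrt (0 + x0))); last first.
    by rewrite add0r s0 s1 -[LHS]nab; field.
  apply: cvgM; first exact: cvg_cst.
  apply: cvgB; first exact: sqrt_cvg.
  have := sqrt_cvg 0; rewrite (_ : (fun e => _) = fun e => Num.sqrt (x0 + e * d)) //.
  by apply/funext => e; rewrite add0r.
exists (fun e => (a * (g e)%:C, b * (h e)%:C)); split=> /=.
- move=> e e0.
  have x0e : 0 <= x0 + e * d by rewrite addr_ge0 // mulr_ge0.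
  have q1 : Num.sqrt (1 + (x0 + e * d)) ^+ 2 = 1 + (x0 + e * d).
    by rewrite sqr_sqrtr // addr_ge0.
  have q2 : Num.sqrt (x0 + e * d) ^+ 2 = x0 + e * d by rewrite sqr_sqrtr.
  have le12 : Num.sqrt (x0 + e * d) <= Num.sqrt (1 + (x0 + e * d)).
    by rewrite ler_wsqrtr // lerDr.
  have g0 : 0 <= g e by rewrite mulr_ge0 // addr_ge0 // sqrtr_ge0.
  have h0 : 0 <= h e by rewrite mulr_ge0 // subr_ge0.
  have gh : g e * h e = 1.
    transitivity (r * r' * (Num.sqrt (1 + (x0 + e * d)) ^+ 2
      - Num.sqrt (x0 + e * d) ^+ 2)); first by rewrite /g /h; ring.
    by rewrite nab q1 q2; ring.
  split.
    by rewrite mulrACA ab1 mul1r -rmorphM gh.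
  rewrite !Normc.normcM !normc_real !ger0_norm // E E'.
  have -> : r * g e - r' * h e = 2 * Num.sqrt (x0 + e * d).
    transitivity (r * r' * (2 * Num.sqrt (x0 + e * d))); last by rewrite nab mul1r.
    by rewrite /g /h; ring.
  by rewrite exprMn q2 /x0; field.
- by rewrite -[X in ccvg _ _ X]mulr1; apply: ccvgM;
    [exact: ccvg_cst|exact: (ccvg_real _ cg)].
- by rewrite -[X in ccvg _ _ X]mulr1; apply: ccvgM;
    [exact: ccvg_cst|exact: (ccvg_real _ ch)].
Qed.

(** Each pair (a i, b i) moves independently along [reciprocal_pair_perturb], and
    [rank_numrange_closed] applies as e decreases to 0. *)
Lemma rank_numrange_tridiag_perturb (R : realType) (k n : nat)
    (a b : nat -> R[i]) (d : nat -> R) (l : R[i]) :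
  (forall i, a i * b i = 1) -> (forall i, 0 <= d i) ->
  (\forall e \near 0^'+, forall a' b' : nat -> R[i],
     (forall i, a' i * b' i = 1) ->
     (forall i, xi a' b' i = xi a b i + e * d i) ->
     rank_numrange k (tridiag n a' b') l) ->
  rank_numrange k (tridiag n a b) l.
Proof.
move=> ab d0 near_l.
have /choice [f hf] i := reciprocal_pair_perturb (ab i) (d0 i).
pose a' e i := (f i e).1; pose b' e i := (f i e).2.
apply: (@rank_numrange_closed R R 0^'+ k n _ (fun e => tridiag n (a' e) (b' e))).
  move=> i j; rewrite (_ : (fun e => _) = fun e => if j == i.+1 :> nat then a' e i
      else if i == j.+1 :> nat then b' e j else 0).
    rewrite mxE; case: ifP => _; first by have [] := hf i.
    by case: ifP => _; [have [] := hf j|exact: ccvg_cst].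
  by apply/funext => e; rewrite mxE.
near=> e; rewrite /=.
have e0 : 0 <= e by apply: ltW; near: e; exact: nbhs_right_gt.
by apply: (near near_l e) => // i; have [h _ _] := hf i; have [] := h e e0.
Unshelve. all: by end_near.
Qed.

(** * The rank-2 numerical range under hypotheses (a) and (b) *)

Lemma normc_lt1_neq0 (R : realType) (z : R[i]) : Normc.normc z < 1 -> 1 + z != 0.
Proof.
move=> z1; apply/eqP => /eqP; rewrite addrC addr_eq0 => /eqP e.
by move: z1; rewrite e normcN Normc.normc1 ltxx.
Qed.

Lemma ellipse_interior_grow (R : realType) (al k be be' : R) (l : R[i]) :
  Normc.normc ((l - al%:C) ^+ 2 - k%:C)
    <= k + 2 * be - Normc.normc (l - al%:C) ^+ 2 ->
  be < be' -> ellipse_interior al k be' l.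
Proof. by rewrite /ellipse_interior => h bb; apply: le_lt_trans h _; lra. Qed.

Lemma xi_ge0 (R : realType) (a b : nat -> R[i]) i : 0 <= xi a b i.
Proof. by rewrite mulr_ge0 ?sqr_ge0 // invr_ge0. Qed.

Lemma ellipse_of_support (R : realType) (al k be : R) (l : R[i]) :
  (forall z, complex.Re (z * (l - al%:C)) ^+ 2
     <= k * complex.Re z ^+ 2 + be * Normc.normc z ^+ 2) ->
  Normc.normc ((l - al%:C) ^+ 2 - k%:C)
    <= k + 2 * be - Normc.normc (l - al%:C) ^+ 2.
Proof.
move=> H; rewrite leNgt; apply/negP => /elliptical_disk_support [z].
by apply/negP; rewrite -leNgt; exact: H.
Qed.

Lemma rank_numrange_tridiag5_sym (R : realType) (a b : nat -> R[i]) (l : R[i])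
    (be t : R) (x := xi a b) :
  (forall i, a i * b i = 1) ->
  x 0%N = be + t -> x 3%N = be - t -> t = 0 \/ t = x 2%N - x 1%N ->
  rank_numrange 2 (tridiag 5 a b) l <->
  Normc.normc ((l - 0%:C) ^+ 2 - 1%:C) <= 1 + 2 * be - Normc.normc (l - 0%:C) ^+ 2.
Proof.
move=> ab x0 x3 tE; split=> [Al|h].
  apply: ellipse_of_support => z; rewrite subr0.
  pose C := complex.Re z ^+ 2; pose N := Normc.normc z ^+ 2.
  (* C + be N is the squared support function of the ellipse with foci 1, -1; the other eigenvalue
     is that of the second factor, with foci sqrt 3, - sqrt 3. *)
  apply: (@rank_numrange_tridiag5_bound R a b l z _
    (3 * C + (be + x 1%N + x 2%N) * N) (1 * C + be * N) ab Al erefl);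
    rewrite -!/(x _) x0 x3 -/C -/N; case: tE => ->; ring.
have [->|l0] := eqVneq l 0; first exact: rank_numrange_tridiag5_0.
(* At a bad [e] the two quadratics share a root in the open disk; half their difference is the
   middle equation, free of [e]. *)
pose bad e := exists z : R[i], [/\ Normc.normc z < 1,
  (1 + z) ^+ 2 + 2 * z * (x 1%N + x 2%N)%:C = 0 &
  ellipse_poly 0 1 (be + e) l z = 0].
(* The roots of the middle equation have product 1, so at most one is in the open disk; the last
   equation is then affine in [e] with slope - 4 z. *)
have bad_uniq e e' : bad e -> bad e' -> e = e'.
  move=> [z [z1 q p]] [z' [z1' q' p']].
  have zz : z = z'.
    apply/eqP; apply/negPn/negP => zz.
    have s0 : z' + z + 2 + 2 * (x 1%N + x 2%N)%:C = 0.
      apply/eqP; have : (z - z') * (z' + z + 2 + 2 * (x 1%N + x 2%N)%:C) == 0.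
        by apply/eqP; rewrite -[RHS](subrr 0) -{1}q -q'; ring.
      by rewrite mulf_eq0 subr_eq0 (negbTE zz).
    have zz1 : z * z' = 1.
      apply/eqP; rewrite -subr_eq0; apply/eqP.
      transitivity (z * (z' + z + 2 + 2 * (x 1%N + x 2%N)%:C)
        - ((1 + z) ^+ 2 + 2 * z * (x 1%N + x 2%N)%:C)); first by ring.
      by rewrite s0 q; ring.
    have := congr1 (@Normc.normc R) zz1; rewrite Normc.normcM Normc.normc1.
    by move: (normc_ge0 z) (normc_ge0 z') => ? ?; nra.
  have zn : z != 0.
    by apply/eqP => z0; move/eqP: q; rewrite z0 !(mulr0, mul0r) !addr0 expr1n oner_eq0.
  have /eqP : 4 * z * (e' - e)%:C = 0.
    rewrite -[RHS](subrr 0) -{1}p -p' -zz /ellipse_poly; ring.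
  rewrite !mulf_eq0 (negbTE zn) orbF pnatr_eq0 /=.
  rewrite -(rmorph0 (real_complex R)) (inj_eq (@complexI R)) subr_eq0.
  by move/eqP.
(* Raising x_0 and x_3 by the same e turns [be] into be + e and keeps [t]. *)
pose d i : R := if (i == 0%N) || (i == 3%N) then 1 else 0.
apply: (@rank_numrange_tridiag_perturb R 2 5 a b d l ab) => [i|].
  by rewrite /d; case: ifP.
near=> e => a' b' ab' xi'.
have e0 : 0 < e by near: e; exact: nbhs_right_gt.
have nbad : ~ bad e by near: e; exact: near_right_avoid.
have y0 : xi a' b' 0%N = be + e + t by rewrite xi' -/(x _) x0 /d /=; ring.
have y3 : xi a' b' 3%N = be + e - t by rewrite xi' -/(x _) x3 /d /=; ring.
have y1 : xi a' b' 1%N = x 1%N by rewrite xi' /d /= mulr0 addr0.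
have y2 : xi a' b' 2%N = x 2%N by rewrite xi' /d /= mulr0 addr0.
have i1 : ellipse_interior 0 1 (be + e) l by apply: ellipse_interior_grow h _; lra.
have x10 : 0 <= x 1%N by exact: xi_ge0.
have x20 : 0 <= x 2%N by exact: xi_ge0.
apply: (@rank_numrange_tridiag5_interior R a' b' 0 1 (be + e) 0 3
  (be + e + x 1%N + x 2%N) l ab' l0) => //.
- by move=> z; rewrite (pencil_poly_factor_sym _ _ y0 y3) y1 y2.
- move: i1; rewrite /ellipse_interior => i1.
  (* The second ellipse contains the first: |l^2 - 3| <= |l^2 - 1| + 2. *)
  have -> : (l - 0%:C) ^+ 2 - 3%:C = ((l - 0%:C) ^+ 2 - 1%:C) + (- 2%:C) by ring.
  apply: le_lt_trans (le_normcD _ _) _; rewrite normcN normc_real ger0_norm //.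
  lra.
- move=> z z1 p1 p2; apply: nbad; exists z; split=> //.
  apply: (@mulfI _ 2); first by rewrite pnatr_eq0.
  by rewrite mulr0 -[RHS](subrr 0) -{1}p1 -p2 /ellipse_poly; ring.
Unshelve. all: by end_near.
Qed.

Lemma rank_numrange_tridiag5_shift (R : realType) (a b : nat -> R[i]) (l : R[i])
    (s := Num.sqrt 3 : R) (al := (s - 1) / 2) (k := (s + 1) / 2) (x := xi a b)
    (y := x 1%N + x 2%N) :
  (forall i, a i * b i = 1) -> x 1%N * x 2%N = 0 ->
  x 0%N = s / 2 * y + x 2%N -> x 3%N = s / 2 * y + x 1%N ->
  rank_numrange 2 (tridiag 5 a b) l <->
  Normc.normc ((l - al%:C) ^+ 2 - (k ^+ 2)%:C)
    <= k ^+ 2 + 2 * (k ^+ 2 * y) - Normc.normc (l - al%:C) ^+ 2 /\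
  Normc.normc ((l - (- al)%:C) ^+ 2 - (k ^+ 2)%:C)
    <= k ^+ 2 + 2 * (k ^+ 2 * y) - Normc.normc (l - (- al)%:C) ^+ 2.
Proof.
move=> ab xx x0 x3.
have s2 : s ^+ 2 = 3 by rewrite sqr_sqrtr.
have s0 : 0 <= s by exact: sqrtr_ge0.
have s1 : 1 < s by nra.
have x10 : 0 <= x 1%N by exact: xi_ge0.
have x20 : 0 <= x 2%N by exact: xi_ge0.
have y0 : 0 <= y by exact: addr_ge0.
split=> [Al|[h1 h2]].
  (* Only the square of the centre matters, so both ellipses are treated at once. *)
  suff sub al' : al' ^+ 2 = al ^+ 2 ->
    Normc.normc ((l - al'%:C) ^+ 2 - (k ^+ 2)%:C)
    <= k ^+ 2 + 2 * (k ^+ 2 * y) - Normc.normc (l - al'%:C) ^+ 2.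
    by split; [exact: (sub al erefl)|exact: (sub (- al) (sqrrN al))].
  move=> al2; apply: ellipse_of_support => z.
  have -> : complex.Re (z * (l - al'%:C)) = complex.Re (z * l) - al' * complex.Re z.
    by case: (z) => ? ?; case: (l) => ? ? /=; ring.
  pose C := complex.Re z; pose N := Normc.normc z ^+ 2; rewrite -/C -/N.
  have N0 : 0 <= N by exact: sqr_ge0.
  (* [r] is the support function of the ellipse moved to centre 0; the eigenvalues are (r + al' C)^2
     and (r - al' C)^2. *)
  pose r := Num.sqrt (k ^+ 2 * C ^+ 2 + k ^+ 2 * y * N).
  have r0 : 0 <= r by exact: sqrtr_ge0.
  have k20 : 0 <= k ^+ 2 by exact: sqr_ge0.
  have kyN : 0 <= k ^+ 2 * y * N by apply: mulr_ge0 => //; exact: mulr_ge0.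
  have r2 : r ^+ 2 = k ^+ 2 * C ^+ 2 + k ^+ 2 * y * N.
    rewrite sqr_sqrtr //; apply: addr_ge0 => //.
    by apply: mulr_ge0 => //; exact: sqr_ge0.
  have alr : `|al' * C| <= r.
    rewrite -(ler_pXn2r (n := 2)) ?nnegrE // real_normK ?num_real //.
    rewrite r2 exprMn al2.
    have : al ^+ 2 <= k ^+ 2 by rewrite /al /k; nra.
    have := sqr_ge0 C; nra.
  have bound (sg : R) : sg ^+ 2 = 1 -> complex.Re (z * l) ^+ 2 <= (r + sg * (al' * C)) ^+ 2.
    move=> sg1.
    apply: (@rank_numrange_tridiag5_bound R a b l z _
      ((r - sg * (al' * C)) ^+ 2) _ ab Al erefl); rewrite -!/(x _) x0 x3 -/C -/N.
      transitivity (2 * r ^+ 2 + 2 * (sg ^+ 2 * al' ^+ 2 * C ^+ 2)); first by ring.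
      rewrite r2 sg1 al2 /al /k /y.
      by field: s2.
    transitivity ((r ^+ 2 - sg ^+ 2 * al' ^+ 2 * C ^+ 2) ^+ 2); first by ring.
    rewrite r2 sg1 al2 /al /k /y.
    by move/eqP: xx; rewrite mulf_eq0 => /orP[] /eqP ->; field: s2.
  (* With w = Re (z l) and q = al' C, where |q| <= r, the two bounds give w <= r + q and - w <= r -
     q, that is |w - q| <= r. *)
  rewrite -r2; have b1 := bound 1 (expr1n _ _).
  have b2 := bound (- 1) (etrans (sqrrN 1) (expr1n _ _)).
  move: alr; rewrite ler_norml => /andP[q1 q2].
  rewrite mul1r in b1; rewrite mulN1r in b2.
  move: (complex.Re (z * l)) (al' * C) q1 q2 b1 b2 => w q q1 q2 b1 b2.
  have wr1 : w <= r + q by rewrite leNgt; apply/negP => h; nra.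
  have wr2 : - w <= r - q by rewrite leNgt; apply/negP => h; nra.
  nra.
have [->|l0] := eqVneq l 0; first exact: rank_numrange_tridiag5_0.
have al0 : al != 0 by rewrite gt_eqF // /al; lra.
have k20 : 0 < k ^+ 2 by rewrite exprn_gt0 // /k; lra.
(* Enlarge the nonzero one of xi_2, xi_3 (either if both vanish), and xi_1, xi_4
   accordingly. *)
have [d [d0 d1 [d2 d3] dy]] : exists d : nat -> R, [/\ forall i, 0 <= d i,
    d 1%N + d 2%N = 1, d 0%N = s / 2 + d 2%N /\ d 3%N = s / 2 + d 1%N &
    forall e, (x 1%N + e * d 1%N) * (x 2%N + e * d 2%N) = 0].
  move/eqP: xx; rewrite mulf_eq0 => /orP[] /eqP z.
    exists (fun i => nth 0 [:: s / 2 + 1; 0; 1; s / 2] i); split=> //=.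
    + by case=> [|[|[|[|[]]]]] //=; lra.
    + by rewrite add0r.
    + by rewrite addr0.
    + by move=> e; rewrite z; ring.
  exists (fun i => nth 0 [:: s / 2; 1; 0; s / 2 + 1] i); split=> //=.
  + by case=> [|[|[|[|[]]]]] //=; lra.
  + by rewrite addr0.
  + by rewrite addr0.
  + by move=> e; rewrite z; ring.
apply: (@rank_numrange_tridiag_perturb R 2 5 a b d l ab d0).
near=> e => a' b' ab' xi'.
have e0 : 0 < e by near: e; exact: nbhs_right_gt.
pose y' := xi a' b' 1%N + xi a' b' 2%N.
have yE : y' = y + e.
  transitivity (y + e * (d 1%N + d 2%N)); last by rewrite d1 mulr1.
  by rewrite /y' !xi' /y -!/(x _); ring.
have by' : k ^+ 2 * y < k ^+ 2 * y' by rewrite ltr_pM2l // yE ltrDl.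
apply: (@rank_numrange_tridiag5_interior R a' b' al (k ^+ 2) (k ^+ 2 * y')
  (- al) (k ^+ 2) (k ^+ 2 * y') l ab' l0).
- exact: ltW.
- exact: ltW.
- move=> z; apply: pencil_poly_factor_shift => //.
  + by rewrite !xi'; exact: dy.
  + by rewrite -/y' yE !xi' -!/(x _) x0 d2; ring.
  + by rewrite -/y' yE !xi' -!/(x _) x3 d3; ring.
- exact: ellipse_interior_grow h1 _.
- exact: ellipse_interior_grow h2 _.
(* At a common root the difference 4 al (z l + conj l) (1 + z) of the two quadratics vanishes, but
   no factor does in the open disk. *)
- move=> z z1 p1 p2.
  have : 4 * al%:C * (z * l + l^*%R) * (1 + z) = 0.
    by rewrite -[RHS](subrr 0) -{1}p2 -p1 /ellipse_poly; ring.
  move/eqP; rewrite !mulf_eq0 (negbTE (normc_lt1_neq0 z1)) orbF pnatr_eq0 /=.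
  rewrite -{1}(rmorph0 (real_complex R)) (inj_eq (@complexI R)) (negbTE al0) /=.
  rewrite addr_eq0 => /eqP /(congr1 (@Normc.normc R)); rewrite normcN Normc.normcM.
  rewrite normc_conj.
  have : 0 < Normc.normc l.
    rewrite lt_def normc_ge0 andbT; apply/eqP => /Normc.eq0_normc /eqP.
    by rewrite (negbTE l0).
  by nra.
Unshelve. all: by end_near.
Qed.

Theorem corollary5 (R : realType) (A : 'M[R[i]]_5) :
  reciprocal A ->
  let xi1 : R := rparam A (0 : 'I_4) in
  let xi2 : R := rparam A (1 : 'I_4) in
  let xi3 : R := rparam A (2%:R : 'I_4) in
  let xi4 : R := rparam A (3%:R : 'I_4) in
  let s3 : R := Num.sqrt 3%:R in
  (xi1 = xi4 \/ xi1 - xi4 = 2%:R * (xi3 - xi2) ->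
     rank_numrange 2 A
     = elliptical_disk 1 (- 1) (Num.sqrt (2%:R * (xi1 + xi4)))) /\
  (xi2 * xi3 = 0 -> xi2 + xi3 != 0 ->
   xi1 = s3 / 2%:R * (xi2 + xi3) + xi3 ->
   xi4 = s3 / 2%:R * (xi2 + xi3) + xi2 ->
     rank_numrange 2 A
     = elliptical_disk s3%:C (- 1) ((1 + s3) * Num.sqrt (xi2 + xi3))
       `&` elliptical_disk (- s3%:C) 1 ((1 + s3) * Num.sqrt (xi2 + xi3))).
Proof.
move=> /reciprocal_tridiag [a [b [ab ->]]] xi1 xi2 xi3 xi4 s3.
have E1 : xi1 = xi a b 0%N by rewrite /xi1 rparam_tridiag.
have E2 : xi2 = xi a b 1%N by rewrite /xi2 rparam_tridiag.
have E3 : xi3 = xi a b 2%N by rewrite /xi3 rparam_tridiag.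
have E4 : xi4 = xi a b 3%N by rewrite /xi4 rparam_tridiag.
rewrite E1 E2 E3 E4.
have x_ge0 := xi_ge0 a b.
split=> [hyp|xx _ x0 x3]; apply/seteqP.
  have fE : elliptical_disk 1 (- 1) (Num.sqrt (2%:R * (xi a b 0%N + xi a b 3%N)))
    = elliptical_disk (0 + 1)%:C (0 - 1)%:C
        (Num.sqrt (2%:R * (xi a b 0%N + xi a b 3%N))).
    by rewrite add0r sub0r rmorphN rmorph1.
  have dE : Num.sqrt (2%:R * (xi a b 0%N + xi a b 3%N)) ^+ 2 / 2
      = 2 * ((xi a b 0%N + xi a b 3%N) / 2).
    by rewrite sqr_sqrtr ?mulr_ge0 ?addr_ge0 //; field.
  have key l : rank_numrange 2 (tridiag 5 a b) l <->
      elliptical_disk 1 (- 1) (Num.sqrt (2%:R * (xi a b 0%N + xi a b 3%N))) l.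
    rewrite fE elliptical_diskE dE expr1n.
    apply: (@rank_numrange_tridiag5_sym R a b l _
      ((xi a b 0%N - xi a b 3%N) / 2)) => //; try by field.
    by case: hyp => h; [left|right]; lra.
  by split=> l /key.
pose k := (s3 + 1) / 2.
have dE : ((1 + s3) * Num.sqrt (xi a b 1%N + xi a b 2%N)) ^+ 2 / 2
    = 2 * (k ^+ 2 * (xi a b 1%N + xi a b 2%N)).
  by rewrite exprMn sqr_sqrtr ?addr_ge0 // /k; field.
have key l : rank_numrange 2 (tridiag 5 a b) l <->
    (elliptical_disk s3%:C (- 1) ((1 + s3) * Num.sqrt (xi a b 1%N + xi a b 2%N)) l
    /\ elliptical_disk (- s3%:C) 1 ((1 + s3) * Num.sqrt (xi a b 1%N + xi a b 2%N)) l).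
  have f1 : s3%:C = ((s3 - 1) / 2 + k)%:C by congr _%:C; rewrite /k; field.
  have f2 : - 1 = ((s3 - 1) / 2 - k)%:C.
    by rewrite (_ : _ - k = - 1) ?rmorphN1 // /k; field.
  (* The half-distance - k puts the foci in the stated order - s3, 1. *)
  have f3 : - s3%:C = (- ((s3 - 1) / 2) + (- k))%:C.
    by rewrite (_ : _ + - k = - s3) ?rmorphN // /k; field.
  have f4 : 1 = (- ((s3 - 1) / 2) - (- k))%:C.
    by rewrite (_ : _ - (- k) = 1) ?rmorph1 // /k; field.
  have e1 d : elliptical_disk s3%:C (- 1) d
      = elliptical_disk ((s3 - 1) / 2 + k)%:C ((s3 - 1) / 2 - k)%:C d.
    by rewrite -f1 -f2.
  have e2 d : elliptical_disk (- s3%:C) 1 d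
      = elliptical_disk (- ((s3 - 1) / 2) + (- k))%:C (- ((s3 - 1) / 2) - (- k))%:C d.
    by rewrite -f3 -f4.
  rewrite e1 e2 !elliptical_diskE dE (sqrrN k).
  exact: rank_numrange_tridiag5_shift.
by split=> l /key.
Qed.
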